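(* Let $X$ be a compact Hausdorff space and $\xi$ a $4n$-dimensional orthogonal real vector bundle over $X$. Then $\xi$ admits an $\mathbb{H}_\lambda$-structure for some complex line bundle $\lambda$ if and only if the structure group of $\xi$ can be reduced to $\mathrm{TSp}(\mathbb{H}^n)\cap\mathrm{U}(\mathbb{H}^n)$; and $\xi$ admits an $\mathbb{H}_\lambda$-structure for some real line bundle $\delta$ and some $\mathbb{C}_\delta$-line bundle $\lambda$ if and only if the structure group of $\xi$ can be reduced to $\mathrm{TSp}(\mathbb{H}^n)\cap\mathrm{TU}(\mathbb{H}^n)$.
   Context: For an oriented $3$-dimensional real vector bundle $\alpha$ with positive-definite inner product, $\mathbb{H}_\alpha$ is the bundle of quaternion algebras $\mathbb{R}1\oplus\alpha$ with multiplication $(s,u)\cdot(t,v)=(st-\langle u,v\rangle,\ sv+tu+u\times v)$. For a real line bundle $\delta$ with inner product, $\mathbb{C}_\delta=\mathbb{R}\oplus\delta$ is the bundle of algebras in which every unit-length element of $\delta_x$ is a square root of $-1$. A $\mathbb{C}_\delta$-line bundle $\lambda$ (real dimension $2$, with inner product) has $\Lambda^2_{\mathbb{R}}\lambda=\delta$, and $\mathbb{H}_\lambda:=\mathbb{H}_{\Lambda^2\lambda\oplus\lambda}=\mathbb{H}_{\delta\oplus\lambda}$; for an ordinary complex line bundle, $\delta$ is trivial. An $\mathbb{H}_\lambda$-structure on a real vector bundle is a left $\mathbb{H}_\lambda$-module structure in each fibre, given by a bundle map. On $V=\mathbb{H}^n$ with its standard left $\mathbb{H}$-module structure (restricted to $\mathbb{C}\subset\mathbb{H}$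 for the complex structure) and standard real inner product, $\mathrm{O}(V)$ is the group of real isometries, $\mathrm{U}(V)\subset\mathrm{O}(V)$ the subgroup of $\mathbb{C}$-linear isometries, $\mathrm{TSp}(V)=\{g\in\mathrm{O}(V)\mid g(rv)=\kappa(r)g(v)\text{ for some }\kappa\in\operatorname{Aut}(\mathbb{H})\text{ and all }v\in V,\ r\in\mathbb{H}\}$, and $\mathrm{TU}(V)=\{g\in\mathrm{O}(V)\mid g(rv)=\kappa(r)g(v)\text{ for some }\kappa\in\operatorname{Aut}_{\mathbb{R}}(\mathbb{C})\text{ and all }v\in V,\ r\in\mathbb{C}\}$, where $\operatorname{Aut}_{\mathbb{R}}(\mathbb{C})$ consists of the identity and complex conjugation. *)

(* Defs.v *)
From HB Require Import structures.
From mathcomp Require Import all_boot all_order all_algebra.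
From mathcomp Require Import complex.
From mathcomp Require Import all_classical all_reals all_analysis.
Import Order.TTheory GRing.Theory Num.Theory.
Import numFieldNormedType.Exports.
Set Implicit Arguments.
Unset Strict Implicit.
Unset Printing Implicit Defensive.
Local Open Scope classical_set_scope.
Local Open Scope ring_scope.

Section Algebra.
Variable R : realType.

Definition is_bilinear (U V W : lmodType R) (f : U -> V -> W) : Prop :=
  (forall u, linear (f u)) /\ (forall v, linear (f^~ v)).

Definition is_inner (V : lmodType R) (ip : V -> V -> R) : Prop :=
  [/\ is_bilinear (ip : V -> V -> R^o),
      forall u v, ip u v = ip v u
    & forall u, u != 0 -> 0 < ip u u].

(* Left module over an R-algebra (A, mul, one), with R-bilinear action. *)
Definition is_left_module (A V : lmodType R) (one : A) (mul : A -> A -> A)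
    (act : A -> V -> V) : Prop :=
  [/\ is_bilinear act,
      forall v, act one v = v
    & forall a b v, act (mul a b) v = act a (act b v)].

Definition is_alg_aut (A : lmodType R) (one : A) (mul : A -> A -> A)
    (kappa : A -> A) : Prop :=
  [/\ linear kappa, bijective kappa, kappa one = one
    & forall a b, kappa (mul a b) = mul (kappa a) (kappa b)].

Definition ip_sum (V W : lmodType R) (ipV : V -> V -> R) (ipW : W -> W -> R)
    (u v : V * W) : R := ipV u.1 v.1 + ipW u.2 v.2.

(* C_D = R + D for a Euclidean line D: a unit vector of D squares to -1. *)
Definition cplx_mul (D : lmodType R) (ip : D -> D -> R) (p q : R^o * D) :
    R^o * D :=
  (p.1 * q.1 - ip p.2 q.2, p.1 *: q.2 + q.1 *: p.2).

(* H_A = R + A for an oriented Euclidean 3-space A with cross product. *)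
Definition quat_mul (A : lmodType R) (ip : A -> A -> R) (cross : A -> A -> A)
    (p q : R^o * A) : R^o * A :=
  (p.1 * q.1 - ip p.2 q.2, p.1 *: q.2 + q.1 *: p.2 + cross p.2 q.2).

(* The cross product of an oriented Euclidean 3-space, the orientation being
   given by the unit volume form [vol]: <u x v, w> = vol u v w for all w. *)
Definition cross_of (A : lmodType R) (ip : A -> A -> R)
    (vol : A -> A -> A -> R) (u v : A) : A :=
  xget 0 [set w : A | forall z, ip w z = vol u v z].

End Algebra.

Section StandardModel.
Variable R : realType.

Definition mxdot (p q : nat) (u v : 'M[R]_(p, q)) : R := \tr (u *m v^T).

(* The indices of 'I_3 are added modulo 3. *)
Definition cross3 (u v : 'rV[R]_3) : 'rV[R]_3 :=
  \row_i (u 0 (i + 1) * v 0 (i + 2) - u 0 (i + 2) * v 0 (i + 1)).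

Definition quat : lmodType R := (R^o * 'rV[R]_3)%type.
Definition qmul : quat -> quat -> quat := quat_mul (@mxdot 1 3) cross3.
Definition qone : quat := (1, 0).

(* H^n is the space of real n x 4 matrices: row i lists the coordinates of the
   i-th quaternion in the basis 1, i, j, k. *)
Definition quat_of_row (v : 'rV[R]_4) : quat :=
  (v 0 0, rsubmx (v : 'rV[R]_(1 + 3))).
Definition row_of_quat (q : quat) : 'rV[R]_4 := row_mx (q.1%:M : 'M[R]_1) q.2.

Definition qscale (n : nat) (r : quat) (v : 'M[R]_(n, 4)) : 'M[R]_(n, 4) :=
  \matrix_(i < n) row_of_quat (qmul r (quat_of_row (row i v))).

Definition quat_of_C (z : R[i]) : quat :=
  (complex.Re z, complex.Im z *: delta_mx 0 0).
Definition cscale (n : nat) (z : R[i]) (v : 'M[R]_(n, 4)) : 'M[R]_(n, 4) :=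
  qscale (quat_of_C z) v.

(* Bijectivity is automatic for linear isometries in finite dimension. *)
Definition OV (n : nat) : set ('M[R]_(n, 4) -> 'M[R]_(n, 4)) :=
  [set g | linear g /\ forall u v, mxdot (g u) (g v) = mxdot u v].

Definition UV (n : nat) : set ('M[R]_(n, 4) -> 'M[R]_(n, 4)) :=
  [set g | OV g /\ forall z v, g (cscale z v) = cscale z (g v)].

Definition TSp (n : nat) : set ('M[R]_(n, 4) -> 'M[R]_(n, 4)) :=
  [set g | OV g /\ exists kappa : quat -> quat, is_alg_aut qone qmul kappa /\
     forall v r, g (qscale r v) = qscale (kappa r) (g v)].

Definition TU (n : nat) : set ('M[R]_(n, 4) -> 'M[R]_(n, 4)) :=
  [set g | OV g /\ exists kappa : {rmorphism R[i] -> R[i]},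
     [/\ bijective kappa, forall t : R, kappa t%:C%C = t%:C%C
       & forall v z, g (cscale z v) = cscale (kappa z) (g v)]].

End StandardModel.

Lemma continuousC (S T U : topologicalType) (f : S -> T) (g : T -> U) :
  continuous f -> continuous g -> continuous (g \o f).
Proof. by move=> fc gc x; apply: continuous_comp; [exact: fc|exact: gc]. Qed.

Section Families.
Variables (R : realType) (X : topologicalType).

(* A family of real vector spaces over X: the disjoint union of the fibres
   carries a topology for which the projection to X is continuous.  (This is
   not the disjoint-union topology that the library puts on sigma types.) *)
Record vfam := VFam {
  fib :> X -> lmodType R;
  tot_class : Topological.axioms_ {x : X & fib x};
  tot_proj : continuous
    (fun e : Topological.Pack tot_class => projT1 e)
}.

Definition tot (E : vfam) : topologicalType := Topological.Pack (tot_class E).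
Definition inTot (E : vfam) (x : X) (v : E x) : tot E := existT (fib E) x v.

Definition fam_map_continuous (E F : vfam) (f : forall x, E x -> F x) : Prop :=
  continuous (fun e : tot E => inTot (f (projT1 e) (projT2 e))).

Definition triv_fib (_ : X) : lmodType R := R^o.
Definition triv_top : topologicalType :=
  initial_topology (fun e : {x : X & triv_fib x} =>
    (projT1 e, projT2 e : R) : X * R).

Lemma triv_proj : continuous (fun e : triv_top => projT1 e).
Proof.
apply: (@continuousC triv_top (X * R)%type X
  (fun e => (projT1 e, projT2 e : R)) fst); first exact: initial_continuous.
by move=> z; exact: cvg_fst.
Qed.

Definition triv_fam : vfam :=
  @VFam triv_fib (Topological.class triv_top) triv_proj.

Lemma triv_val_continuous : continuous (fun e : tot triv_fam => projT2 e : R).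
Proof.
apply: (@continuousC triv_top (X * R)%type R
  (fun e => (projT1 e, projT2 e : R)) snd); first exact: initial_continuous.
by move=> z; exact: cvg_snd.
Qed.

Section WhitneySum.
Variables E F : vfam.
Definition sum_fib (x : X) : lmodType R := (E x * F x)%type.
Definition sum_top : topologicalType :=
  initial_topology (fun e : {x : X & sum_fib x} =>
    (inTot (projT2 e).1, inTot (projT2 e).2) : tot E * tot F).

Lemma sum_top_fst :
  continuous (fun e : sum_top => inTot (projT2 e).1 : tot E).
Proof.
apply: (@continuousC sum_top (tot E * tot F)%type (tot E)
  (fun e => (inTot (projT2 e).1, inTot (projT2 e).2)) fst).
  exact: initial_continuous.
by move=> z; exact: cvg_fst.
Qed.

Lemma sum_top_snd :
  continuous (fun e : sum_top => inTot (projT2 e).2 : tot F).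
Proof.
apply: (@continuousC sum_top (tot E * tot F)%type (tot F)
  (fun e => (inTot (projT2 e).1, inTot (projT2 e).2)) snd).
  exact: initial_continuous.
by move=> z; exact: cvg_snd.
Qed.

Lemma sum_proj : continuous (fun e : sum_top => projT1 e).
Proof.
exact: (@continuousC sum_top (tot E) X _ (fun e => projT1 e) sum_top_fst
  (@tot_proj E)).
Qed.

Definition sum_fam : vfam :=
  @VFam sum_fib (Topological.class sum_top) sum_proj.
End WhitneySum.

(* [h] is a local trivialisation over the open set U: it induces a
   homeomorphism U x M_(p,q)(R) -> E|U that is linear on fibres. *)
Definition is_chart (E : vfam) (p q : nat) (U : set X)
    (h : forall x, 'M[R]_(p, q) -> E x) : Prop :=
  [/\ open U,
      forall x, U x -> linear (h x),
      {within U `*` [set: 'M[R]_(p, q)],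
        continuous (fun z : X * 'M[R]_(p, q) => inTot (h z.1 z.2))}
    & exists k : forall x, E x -> 'M[R]_(p, q),
        (forall x, U x -> cancel (h x) (k x) /\ cancel (k x) (h x)) /\
        {within [set e : tot E | U (projT1 e)],
          continuous (fun e : tot E => k (projT1 e) (projT2 e))}].

(* Real vector bundle of rank m with a positive-definite inner product. *)
Record orth_bundle (m : nat) := OrthBundle {
  ob_fam :> vfam;
  ip : forall x, ob_fam x -> ob_fam x -> R;
  ip_inner : forall x, is_inner (@ip x);
  ip_continuous : continuous (fun e : tot (sum_fam ob_fam ob_fam) =>
    ip (projT2 e).1 (projT2 e).2);
  ob_loctriv : forall x : X, exists (U : set X)
    (h : forall y, 'M[R]_(1, m) -> ob_fam y), U x /\ is_chart U h
}.

Definition triv_ip (x : X) (u v : triv_fam x) : R := (u : R) * (v : R).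

Lemma triv_ip_inner (x : X) : is_inner (@triv_ip x).
Proof.
rewrite /triv_ip; split=> [|u v|u u0].
- split=> u a v w; first by rewrite mulrDr -scalerAr.
  by rewrite mulrDl -scalerAl.
- exact: mulrC.
- by rewrite -expr2 lt_neqAle sqr_ge0 eq_sym sqrf_eq0 u0.
Qed.

Lemma triv_ip_continuous : continuous
  (fun e : tot (sum_fam triv_fam triv_fam) =>
    triv_ip (projT2 e).1 (projT2 e).2).
Proof.
move=> e.
pose f1 (e : tot (sum_fam triv_fam triv_fam)) : R := (projT2 e).1.
pose f2 (e : tot (sum_fam triv_fam triv_fam)) : R := (projT2 e).2.
have c1 : continuous f1.
  exact: (@continuousC (tot (sum_fam triv_fam triv_fam)) (tot triv_fam) R _ _
    (@sum_top_fst triv_fam triv_fam) triv_val_continuous).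
have c2 : continuous f2.
  exact: (@continuousC (tot (sum_fam triv_fam triv_fam)) (tot triv_fam) R _ _
    (@sum_top_snd triv_fam triv_fam) triv_val_continuous).
exact: (cvgM (c1 e) (c2 e)).
Qed.

Lemma triv_loctriv (x : X) : exists (U : set X)
  (h : forall y, 'M[R]_(1, 1) -> triv_fam y), U x /\ is_chart U h.
Proof.
exists [set: X], (fun y v => v 0 0); split => //; split.
- exact: openT.
- by move=> y _ a u v; rewrite !mxE.
- rewrite setXTT; apply: continuous_subspaceT.
  apply: (@continuous_comp_initial _ (X * 'M[R]_(1, 1))%type (X * R)%type
    (fun e : {x : X & triv_fib x} => (projT1 e, projT2 e : R))).
  have c0 : continuous (fun v : 'M[R]_(1, 1) => v 0 0).
    exact: coord_continuous.
  have c2 : continuous (fun z : X * 'M[R]_(1, 1) => z.2 0 0).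
    apply: (@continuousC (X * 'M[R]_(1, 1))%type 'M[R]_(1, 1) R snd _ _ c0).
    by move=> w; exact: cvg_snd.
  have c1 : continuous (fun z : X * 'M[R]_(1, 1) => z.1).
    by move=> w; exact: cvg_fst.
  by move=> z; exact: (cvg_pair (c1 z) (c2 z)).
- exists (fun y a => const_mx (a : R)); split.
    move=> y _; split=> [v|a]; last by rewrite mxE.
    by apply/matrixP => i j; rewrite !mxE !ord1.
  apply: continuous_subspaceT.
  apply: (@continuousC (tot triv_fam) R 'M[R]_(1, 1) _ const_mx
    triv_val_continuous).
  move=> a A [P aP PA]; have := aP 0 0; rewrite mxE.
  apply: filterS => b Pb; apply: PA => i j.
  by rewrite mxE !ord1.
Qed.

Definition triv_line : orth_bundle 1 :=
  OrthBundle triv_ip_inner triv_ip_continuous triv_loctriv.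

(* A C_delta-line bundle: a real plane bundle with a continuous C_delta-module
   structure on the fibres for which |z v| = |z| |v|.  When [delta] is
   [triv_line] the fibres of C_delta are the complex numbers. *)
Record C_line (delta : orth_bundle 1) := CLine {
  cl_bundle :> orth_bundle 2;
  cl_act : forall x, sum_fam triv_fam delta x -> cl_bundle x -> cl_bundle x;
  cl_module : forall x,
    is_left_module (1, 0) (cplx_mul (@ip 1 delta x)) (@cl_act x);
  cl_continuous : fam_map_continuous
    (E := sum_fam (sum_fam triv_fam delta) cl_bundle)
    (fun x e => cl_act e.1 e.2);
  cl_isometric : forall x (z : sum_fam triv_fam delta x) (v : cl_bundle x),
    ip (cl_act z v) (cl_act z v) = (z.1 ^+ 2 + ip z.2 z.2) * ip v v
}.

Definition complex_line := C_line triv_line.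

Section HStructure.
Variables (delta : orth_bundle 1) (lam : C_line delta).

Definition im_fam : vfam := sum_fam delta lam.
Definition H_fam : vfam := sum_fam triv_fam im_fam.

(* The canonical orientation of Lambda^2 lam + lam.  The isomorphism
   Lambda^2 lam = delta is given by <a, v /\ w> = <a v, w>, so v /\ (a v) = a
   for unit vectors a in delta, v in lam, and (a, v, a v) is an oriented
   orthonormal basis of delta + lam.  (Each summand below is the wedge of a
   delta-component with the two complementary lam-components.) *)
Definition im_vol (x : X) (u v w : im_fam x) : R :=
  let m (a : delta x) (b c : lam x) := ip (cl_act (0, a) b) c in
  m u.1 v.2 w.2 - m v.1 u.2 w.2 + m w.1 u.2 v.2.

Definition im_ip (x : X) : im_fam x -> im_fam x -> R :=
  ip_sum (@ip 1 delta x) (@ip 2 lam x).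

Definition im_cross (x : X) : im_fam x -> im_fam x -> im_fam x :=
  cross_of (@im_ip x) (@im_vol x).

(* The choice in [cross_of] is well defined: the vector exists (and is unique,
   [im_ip] being definite). *)
Lemma im_crossP (x : X) (u v w : im_fam x) :
  im_ip (im_cross u v) w = im_vol u v w.
Proof.
have [U [h [Ux [_ hl _ [k [hk _]]]]]] := ob_loctriv delta x.
have [hK kK] := hk x Ux.
pose e : delta x := h x (const_mx 1).
have dbl (V : zmodType) (b : V) : b = b + b -> b = 0.
  by move=> bb; apply: (addIr b); rewrite add0r -bb.
have h0 : h x 0 = 0.
  by have := hl x Ux 1 0 0; rewrite !scale1r addr0 => /dbl.
have hZ a y : h x (a *: y) = a *: h x y.
  by rewrite -[a *: y]addr0 (hl x Ux) h0 addr0.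
have eP c : c = k x c 0 0 *: e.
  rewrite -[LHS]kK -hZ; congr (h x _).
  by apply/matrixP => i j; rewrite !mxE !ord1 mulr1.
have e0 : e != 0.
  apply/eqP => e0; have := hK (const_mx 1).
  rewrite -/e e0 -h0 hK => /matrixP/(_ 0 0); rewrite !mxE => /eqP.
  by rewrite eq_sym oner_eq0.
have [[[dl dr] dC dpos] [[ll lr] lC lpos]] := (ip_inner delta x, ip_inner lam x).
have [[al ar] a1 am] := cl_module lam x.
have de : ip e e != 0 by rewrite gt_eqF // dpos.
have ipZ m (B : orth_bundle m) (a : R) (y z : B x) :
    ip (a *: y) z = a * ip y z.
  have [[_ br] _ _] := ip_inner B x.
  have b0 : ip (0 : B x) z = 0.
    by have := br z 1 0 0; rewrite !scale1r addr0 => /dbl.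
  by rewrite -[a *: y]addr0 (br z) b0 addr0.
have aZ (a : R) (c : delta x) z :
    cl_act (0, a *: c) z = a *: cl_act (0, c) z :> lam x.
  have b0 : cl_act (0 : sum_fam triv_fam delta x) z = 0 :> lam x.
    by have := ar z 1 0 0; rewrite !scale1r addr0 => /dbl.
  rewrite -[RHS]addr0 -b0 -ar; congr (cl_act _ z).
  by rewrite addr0; congr pair; rewrite /= scaler0.
have ipB (y z t : lam x) : ip (y - z) t = ip y t - ip z t.
  by rewrite addrC -scaleN1r (lr t) scaleN1r addrC.
pose om : delta x := (ip (cl_act (0, e) u.2) v.2 / ip e e : R) *: e.
rewrite /im_cross /cross_of; case: xgetP => [y _ /(_ w) //|/(_
  (om, cl_act (0, u.1) v.2 - cl_act (0, v.1) u.2))] [] z.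
rewrite /im_ip /ip_sum /im_vol /= ipB addrC; congr (_ + _).
rewrite [z.1]eP aZ ipZ /om [LHS]dC !ipZ dC ipZ.
by rewrite divfK.
Qed.

Definition H_mul (x : X) : H_fam x -> H_fam x -> H_fam x :=
  quat_mul (@im_ip x) (@im_cross x).

(* The module structure is not required to preserve the inner product of xi. *)
Definition has_H_structure (m : nat) (xi : orth_bundle m) : Prop :=
  exists act : forall x, H_fam x -> xi x -> xi x,
    (forall x, is_left_module (1, 0) (@H_mul x) (@act x)) /\
    fam_map_continuous (E := sum_fam H_fam xi) (fun x e => act x e.1 e.2).

End HStructure.

(* The structure group of xi, a priori O(H^n), reduces to G: xi has an atlas of
   isometric local trivialisations with transition functions in G. *)
Definition reduces_to (n m : nat) (xi : orth_bundle m)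
    (G : set ('M[R]_(n, 4) -> 'M[R]_(n, 4))) : Prop :=
  exists (I : Type) (U : I -> set X)
    (h : forall (i : I) (x : X), 'M[R]_(n, 4) -> xi x),
  [/\ forall x, exists i, U i x,
      forall i, is_chart (U i) (h i),
      forall i x, U i x -> forall v w, ip (h i x v) (h i x w) = mxdot v w
    & forall i j x, U i x -> U j x ->
        exists2 g, G g & forall v, h j x v = h i x (g v)].

End Families.

(* Main.v *)
From HB Require Import structures.
From mathcomp Require Import all_boot all_order all_algebra spectral.
From mathcomp Require Import complex ring.
From mathcomp Require Import all_classical all_reals all_analysis.
Require Import Defs.

(** A local frame of H_lambda consists of a unit section a of delta and a unit section
    f of lambda: (a, f, a f) plays the role of (i, j, k) and identifies H_lambda with
    the standard algebra H ([frameM]). Two frames differ by an automorphism of H that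
    maps i to plus or minus i, and to i itself when delta is trivialised by a global
    section. The theorem compares such families of automorphisms with the
    automorphisms over which the transition functions of an atlas of xi are semilinear.

    Given an H_lambda-structure on xi, a quaternionic basis of one fibre extends to a
    quaternionic frame F nearby, but F need not be isometric, and the structure need
    not preserve the inner product of xi. Let ip' be the trace over H of
    (r, s) |-> <r u, s v>: it is an H-invariant inner product, and it does not depend on
    the local frame of H_lambda because automorphisms of H are orthogonal. The inverse
    square root of the Gram matrix of F for ip' commutes with H, so it turns F into an
    H-linear ip'-isometry; a second inverse square root, for the inner product of xi,
    gives the polar part of this frame, which is an isometric chart. Inverse square
    roots are equivariant under orthogonal matrices ([isqrt_conj]), so polar parts of
    two frames have the same transition function as the frames themselves: orthogonal
    and semilinear ([unitary_transition]). Continuity of all this is [cvg_isqrt].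

    Conversely, if h_j = h_i g over the intersection of two charts, with g semilinear
    over kappa, then kappa is determined by g, depends continuously on the base point
    and satisfies the cocycle condition ([change_of_frame]). Its restriction to the line
    R i is a sign and glues to delta; its restriction to the plane C j glues to lambda
    ([line_bundle], [C_line_exists]). By construction H_lambda is glued from copies of H
    along kappa, so the standard action on H^n descends to xi ([H_structure_exists]). *)

Import Order.TTheory GRing.Theory Num.Theory.
Import numFieldNormedType.Exports.
Set Implicit Arguments.
Unset Strict Implicit.
Unset Printing Implicit Defensive.
Local Open Scope classical_set_scope.
Local Open Scope ring_scope.

(** * Positive definite matrices *)

Section PositiveDefinite.
Variable R : realType.

Lemma mxdotE p q (u v : 'M[R]_(p, q)) : mxdot u v = \sum_i \sum_j u i j * v i j.
Proof.
by apply: eq_bigr => i _; rewrite !mxE; apply: eq_bigr => j _; rewrite mxE.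
Qed.

Lemma mxdotC p q (u v : 'M[R]_(p, q)) : mxdot u v = mxdot v u.
Proof.
by rewrite !mxdotE; do 2![apply: eq_bigr => ? _]; rewrite mulrC.
Qed.

Lemma mxdotDl p q (u v w : 'M[R]_(p, q)) : mxdot (u + v) w = mxdot u w + mxdot v w.
Proof. by rewrite /mxdot mulmxDl mxtraceD. Qed.

Lemma mxdotZl p q a (u w : 'M[R]_(p, q)) : mxdot (a *: u) w = a * mxdot u w.
Proof. by rewrite /mxdot -scalemxAl mxtraceZ. Qed.

Lemma mxdotDr p q (u v w : 'M[R]_(p, q)) : mxdot w (u + v) = mxdot w u + mxdot w v.
Proof. by rewrite mxdotC mxdotDl !(mxdotC w). Qed.

Lemma mxdotZr p q a (u w : 'M[R]_(p, q)) : mxdot w (a *: u) = a * mxdot w u.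
Proof. by rewrite mxdotC mxdotZl (mxdotC w). Qed.

Lemma mxdot_ge0 p q (u : 'M[R]_(p, q)) : 0 <= mxdot u u.
Proof.
by rewrite mxdotE; do 2![apply: sumr_ge0 => ? _]; rewrite -expr2 sqr_ge0.
Qed.

Lemma mxdot_ge p q (u : 'M[R]_(p, q)) i j : (u i j) ^+ 2 <= mxdot u u.
Proof.
rewrite mxdotE (bigD1 i) //= (bigD1 j) //= -addrA -expr2 lerDl addr_ge0 //.
  by apply: sumr_ge0 => k _; rewrite -expr2 sqr_ge0.
by do 2![apply: sumr_ge0 => ? _]; rewrite -expr2 sqr_ge0.
Qed.

Lemma mxdot_eq0 p q (u : 'M[R]_(p, q)) : (mxdot u u == 0) = (u == 0).
Proof.
apply/eqP/eqP => [u0|->]; last by rewrite /mxdot mul0mx mxtrace0.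
apply/matrixP => i j; rewrite mxE; apply/eqP; rewrite -sqrf_eq0 eq_le sqr_ge0.
by rewrite andbT -u0 mxdot_ge.
Qed.

Lemma mxdot_gt0 p q (u : 'M[R]_(p, q)) : (0 < mxdot u u) = (u != 0).
Proof. by rewrite lt_neqAle mxdot_ge0 andbT eq_sym mxdot_eq0. Qed.

Lemma mxdot_mulr p q r (u : 'M[R]_(p, q)) (A : 'M[R]_(r, q)) (v : 'M[R]_(p, r)) :
  mxdot u (v *m A) = mxdot (u *m A^T) v.
Proof. by rewrite /mxdot trmx_mul mulmxA. Qed.

Lemma mxdot_tr p q (u v : 'M[R]_(p, q)) : mxdot u^T v^T = mxdot u v.
Proof. by rewrite /mxdot trmxK -mxtrace_tr trmx_mul trmxK mxtrace_mulC. Qed.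

Lemma mxdot_row p q (u v : 'M[R]_(p, q)) :
  mxdot u v = \sum_i mxdot (row i u) (row i v).
Proof.
rewrite mxdotE; apply: eq_bigr => i _; rewrite mxdotE big_ord1.
by apply: eq_bigr => j _; rewrite !mxE.
Qed.

Lemma mxdot_CS p q (u v : 'M[R]_(p, q)) :
  (mxdot u v) ^+ 2 <= mxdot u u * mxdot v v.
Proof.
have [->|v0] := eqVneq v 0.
  by rewrite /mxdot trmx0 !mulmx0 mxtrace0 expr0n mulr0.
have vv : 0 < mxdot v v by rewrite mxdot_gt0.
have := mxdot_ge0 (mxdot v v *: u - mxdot u v *: v).
rewrite -scaleNr mxdotDl !mxdotDr !mxdotZl !mxdotZr (mxdotC v u).
set a := mxdot u u; set b := mxdot u v; set c := mxdot v v in vv *.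
have -> : c * (c * a) + c * (- b * b) + (- b * (c * b) + - b * (- b * c)) =
  c * (a * c - b ^+ 2) by ring.
by rewrite pmulr_rge0 // subr_ge0.
Qed.

(** The entries of u A are inner products of the rows of u with the columns of A,
    so Cauchy-Schwarz makes the Frobenius norm submultiplicative. *)
Lemma mxdot_mul_le p q r (u : 'M[R]_(p, q)) (A : 'M[R]_(q, r)) :
  mxdot (u *m A) (u *m A) <= mxdot u u * mxdot A A.
Proof.
rewrite mxdotE (mxdot_row u) mulr_suml; apply: ler_sum => i _.
rewrite -(mxdot_tr A) (mxdot_row A^T) mulr_sumr; apply: ler_sum => j _.
have -> : (u *m A) i j = mxdot (row i u) (row j A^T).
  by rewrite mxdotE big_ord1 !mxE; apply: eq_bigr => k _; rewrite !mxE.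
by rewrite -expr2; exact: mxdot_CS.
Qed.

Definition posdef n (M : 'M[R]_n) : Prop :=
  M^T = M /\ forall v : 'rV[R]_n, v != 0 -> 0 < mxdot (v *m M) v.

Lemma posdef_unit n (M : 'M[R]_n) : posdef M -> M \in unitmx.
Proof.
case=> _ Mpos; rewrite -row_free_unit; apply: inj_row_free => v vM.
apply/eqP/negPn/negP => /Mpos; rewrite vM /mxdot mul0mx mxtrace0.
by rewrite ltxx.
Qed.

Lemma posdef_gram p n (A : 'M[R]_(p, n)) : row_free A -> posdef (A *m A^T).
Proof.
move=> fA; split; first by rewrite trmx_mul trmxK.
move=> v v0; rewrite mulmxA mxdotC mxdot_mulr trmxK mxdot_gt0.
by rewrite mulmx_free_eq0.
Qed.

Lemma posdef_sqr n (C : 'M[R]_n) : C^T = C -> C \in unitmx -> posdef (C *m C).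
Proof.
by move=> Cs uC; rewrite -{2}Cs; apply: posdef_gram; rewrite row_free_unit.
Qed.

Lemma posdef_ge0 n p (T : 'M[R]_n) (D : 'M[R]_(p, n)) : posdef T ->
  0 <= mxdot (D *m T) D ?= iff (D == 0).
Proof.
move=> [Ts Tpos]; rewrite mxdot_row.
have le i : 0 <= mxdot (row i (D *m T)) (row i D) ?= iff (row i D == 0).
  rewrite row_mul; have [->|d0] := eqVneq (row i D) 0.
    by rewrite /mxdot !mul0mx mxtrace0; split; rewrite ?eqxx.
  by have d1 := Tpos _ d0; split; [rewrite ltW | rewrite lt_eqF].
have := leif_sum (fun i (_ : true) => le i); rewrite big1 //.
congr (_ <= _ ?= iff _); apply/forallP/eqP => [r0|-> i]; last by rewrite row0 eqxx.
by apply/row_matrixP => i; rewrite row0; apply/eqP/(implyP (r0 i)).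
Qed.

(** The difference D of the two roots satisfies T D + D S = 0; pairing this with D
    writes 0 as a sum of two nonnegative terms, the second of which vanishes only
    for D = 0. *)
Lemma posdef_sqrt_uniq n (T S : 'M[R]_n) :
  posdef T -> posdef S -> T *m T = S *m S -> T = S.
Proof.
move=> pT pS eqTS; apply/eqP; rewrite -subr_eq0; set D := T - S.
have TS : T *m D + D *m S = 0.
  by rewrite /D mulmxBr mulmxBl eqTS addrA subrK subrr.
have Dt : mxdot (D^T *m T) D^T + mxdot (D *m S) D = 0.
  have [Ts _] := pT; rewrite -{1}Ts -trmx_mul mxdot_tr -mxdotDl TS.
  by rewrite /mxdot mul0mx mxtrace0.
have D1 : 0 <= mxdot (D^T *m T) D^T by rewrite posdef_ge0.
have D2 : 0 <= mxdot (D *m S) D ?= iff (D == 0) by exact: posdef_ge0.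
by rewrite -D2.2 eq_le D2.1 -[leRHS]Dt lerDr.
Qed.

Lemma interpolation (F : fieldType) (f : F -> F) (s : seq F) :
  exists p : {poly F}, forall x, x \in s -> p.[x] = f x.
Proof.
elim: s => [|d s [p hp]]; first by exists 0.
have [ds|ds] := boolP (d \in s).
  by exists p => x; rewrite inE => /orP[/eqP ->|]; apply: hp.
pose q := \prod_(y <- s) ('X - y%:P).
have qd : q.[d] != 0 by rewrite -[_ == 0]/(root q d) root_prod_XsubC.
exists (p + ((f d - p.[d]) / q.[d]) *: q) => x.
rewrite inE !hornerE => /orP[/eqP ->|xs]; first by rewrite divfK // subrKC.
have /eqP -> : root q x by rewrite root_prod_XsubC.
by rewrite mulr0 addr0 hp.
Qed.

Lemma horner_mx_tr (F : comNzRingType) n (M : 'M[F]_n.+1) p :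
  (horner_mx M p)^T = horner_mx M^T p.
Proof.
elim/poly_ind: p => [|p c IH]; first by rewrite !rmorph0 trmx0.
rewrite !rmorphD !rmorphM /= !horner_mx_X !horner_mx_C raddfD /= tr_scalar_mx.
rewrite trmx_mul IH; congr (_ + _).
by apply/esym/comm_horner_mx; rewrite /comm_mx.
Qed.

(** Over the complex numbers M is unitarily diagonalisable, with real positive
    eigenvalues d.  A real polynomial p with p(d)^4 = 1/d for each of them gives
    the real symmetric matrix C = p(M).  The fourth root is taken because its
    square is then visibly positive definite. *)
Lemma posdef_root n (M : 'M[R]_n) : posdef M ->
  exists2 C : 'M[R]_n, C^T = C & (C *m C) *m (C *m C) *m M = 1%:M.
Proof.
case: n M => [|n] M [Ms Mpos].
  by exists 0; apply/matrixP => - [].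
pose toC := real_complex R; pose Mc := map_mx toC M.
have Mherm : Mc \is hermsymmx.
  apply: realsym_hermsym.
    apply/is_hermitianmxP => /=.
    by rewrite expr0 scale1r map_mx_id // /Mc map_trmx Ms.
  by apply/mxOverP => i j; rewrite mxE complex_real.
have /orthomx_spectralP := hermitian_normalmx Mherm.
set P := spectralmx Mc; set D := spectral_diag Mc => eqM.
have uP : P \in unitmx by exact: spectral_unit.
pose d k := complex.Re (D 0 k).
have dD k : D 0 k = toC (d k).
  have /mxOverP/(_ 0 k)/complex_realP [x Dx] := hermitian_spectral_diag_real Mherm.
  by rewrite /d /D Dx.
have PM k : row k P *m Mc = toC (d k) *: row k P.
  rewrite eqM !mulmxA -row_mul mulmxV // row1.
  by rewrite -[X in X *m P]rowE row_diag_mx -scalemxAl -rowE dD.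
have dpos k : 0 < d k.
  have partM (f : R[i] -> R) : {morph f : x y / x + y} -> f 0 = 0 ->
      (forall x y, f (x * toC y) = f x * y) ->
      map_mx f (row k P) != 0 -> 0 < d k.
    move=> fD f0 fM u0; have := Mpos _ u0.
    suff -> : map_mx f (row k P) *m M = d k *: map_mx f (row k P).
      by rewrite mxdotZl pmulr_lgt0 // mxdot_gt0.
    transitivity (map_mx f (row k P *m Mc)).
      apply/rowP => j; rewrite !mxE (big_morph f fD f0); apply: eq_bigr => l _.
      by rewrite !mxE fM.
    by rewrite PM; apply/rowP => j; rewrite !mxE mulrC fM mulrC.
  have [r0|] := eqVneq (map_mx (@complex.Re R) (row k P)) 0; last first.
    apply: (partM (@complex.Re R)) => // [[a b] [a' b'] //|[a b] y /=].
    by rewrite mulr0 subr0.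
  apply: (partM (@complex.Im R)) => // [[a b] [a' b'] //|[a b] y /=|].
    by rewrite mulr0 add0r.
  apply/eqP => i0.
  have : row k P = 0.
    apply/rowP => j; have /rowP/(_ j) := r0; have /rowP/(_ j) := i0.
    by rewrite !mxE; case: (P k j) => a b /= -> ->.
  rewrite rowE => /(congr1 (mulmx^~ (invmx P))); rewrite mul0mx mulmxK //.
  by move=> /rowP/(_ k)/eqP; rewrite !mxE !eqxx oner_eq0.
have [p hp] := interpolation (fun x => Num.sqrt (Num.sqrt x^-1))
  [seq d k | k : 'I_n.+1].
exists (horner_mx M p); first by rewrite horner_mx_tr Ms.
apply: (@map_mx_inj _ _ toC).
rewrite -[X in X *m M]/((_ * _) * (_ * _)) -!rmorphM !map_mxM map_mx1 /=.
rewrite map_horner_mx -/Mc.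
rewrite -[X in _ *m X]horner_mx_X -[LHS]rmorphM /=.
have EM : Mc = invmx P *m diag_mx D *m invmx (invmx P) by rewrite invmxK.
rewrite EM horner_mx_uconj ?unitmx_inv // horner_mx_diag.
have -> : map_mx (horner (map_poly toC (p * p * (p * p)) * 'X)) D = const_mx 1.
  apply/rowP => k; rewrite !mxE hornerM hornerX dD horner_map.
  rewrite !hornerM hp; last by apply: codom_f.
  by rewrite -!expr2 !sqr_sqrtr ?sqrtr_ge0 ?invr_ge0 ?ltW // -rmorphM mulVf
    ?rmorph1 // gt_eqF.
by rewrite diag_const_mx mulmx1 mulmxV // unitmx_inv.
Qed.

Lemma posdef_isqrt_ex n (M : 'M[R]_n) : posdef M ->
  exists T, posdef T /\ T *m M *m T = 1%:M.
Proof.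
move=> /posdef_root[C Cs CM]; exists (C *m C).
have uC : C \in unitmx by move: CM; rewrite -!mulmxA => /mulmx1_unit[].
by split; [exact: posdef_sqr | apply: mulmx1C; rewrite mulmxA].
Qed.

Definition isqrt n (M : 'M[R]_n) : 'M[R]_n :=
  xget 0 [set T | posdef T /\ T *m M *m T = 1%:M].

Lemma isqrtP n (M : 'M[R]_n) : posdef M ->
  posdef (isqrt M) /\ isqrt M *m M *m isqrt M = 1%:M.
Proof. by move=> /posdef_isqrt_ex ex; apply: (xgetPex 0 ex). Qed.

Lemma isqrt_posdef n (M : 'M[R]_n) : posdef M -> posdef (isqrt M).
Proof. by case/isqrtP. Qed.

Lemma isqrt_sqr n (M : 'M[R]_n) : posdef M -> isqrt M *m isqrt M = invmx M.
Proof.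
move=> pM; have [_ /mulmx1C] := isqrtP pM; rewrite mulmxA => TTM.
by rewrite -[RHS]mul1mx -TTM mulmxK // posdef_unit.
Qed.

Lemma isqrt_uniq n (M T : 'M[R]_n) : posdef M -> posdef T ->
  T *m M *m T = 1%:M -> isqrt M = T.
Proof.
move=> pM pT /mulmx1C; rewrite mulmxA => TTM.
apply: posdef_sqrt_uniq (isqrt_posdef pM) pT _.
by rewrite isqrt_sqr // -[LHS]mul1mx -TTM mulmxK // posdef_unit.
Qed.

Lemma posdef_conj n p (M : 'M[R]_n) (A : 'M[R]_(p, n)) : row_free A -> posdef M ->
  posdef (A *m M *m A^T).
Proof.
move=> fA [Ms Mpos]; split; first by rewrite !trmx_mul trmxK Ms mulmxA.
move=> v v0; rewrite mulmxA mxdotC mxdot_mulr trmxK mxdotC mulmxA.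
by apply: Mpos; rewrite mulmx_free_eq0.
Qed.

Lemma orthogonal_unit n (A : 'M[R]_n) : A *m A^T = 1%:M -> A \in unitmx.
Proof. by case/mulmx1_unit. Qed.

(** By uniqueness the inverse square root is equivariant under orthogonal matrices;
    this makes the constructions below independent of the frames used. *)
Lemma isqrt_conj n (M A : 'M[R]_n) : posdef M -> A *m A^T = 1%:M ->
  isqrt (A *m M *m A^T) = A *m isqrt M *m A^T.
Proof.
move=> pM oA; have fA : row_free A by rewrite row_free_unit orthogonal_unit.
have oA' := mulmx1C oA.
apply: isqrt_uniq; [exact: posdef_conj|exact/posdef_conj/isqrt_posdef|].
have [_ TMT] := isqrtP pM; set T := isqrt M in TMT *.
transitivity (A *m (T *m M *m T) *m A^T); last by rewrite TMT mulmx1.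
by rewrite !mulmxA -!(mulmxA _ A^T A) oA' !mulmx1.
Qed.

(** Writing v = (v S^-1) S with S the inverse square root of T, the form of T at v is
    |v S^-1|^2, and |v|^2 is at most |v S^-1|^2 |S|^2. *)
Lemma posdef_lower n (T : 'M[R]_n) : posdef T ->
  exists2 c : R, 0 < c & forall p (D : 'M[R]_(p, n)), c * mxdot D D <= mxdot
    (D *m T) D.
Proof.
move=> pT; pose S := isqrt T; have pS : posdef S by exact: isqrt_posdef.
have uS := posdef_unit pS.
(* Adding 1 keeps the constant positive in dimension 0. *)
have c0 : 0 < mxdot S S + 1 by rewrite ltr_wpDl ?mxdot_ge0.
exists (mxdot S S + 1)^-1 => [|p D]; first by rewrite invr_gt0.
rewrite mulrC ler_pdivrMr //.
rewrite -[D](mulmxKV uS); set E := D *m invmx S.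
have -> : mxdot (E *m S *m T) (E *m S) = mxdot E E.
  have [Ss _] := pS; have [_ STS] := isqrtP pT.
  by rewrite mxdot_mulr Ss -!mulmxA (mulmxA S) STS mulmx1.
apply: le_trans (mxdot_mul_le _ _) _.
by rewrite ler_wpM2l ?mxdot_ge0 // lerDl ler01.
Qed.

(** * Limits of matrices *)

Section Limits.
Context {T : Type} {F : set_system T} {FF : Filter F}.

Lemma cvg_mxP p q (f : T -> 'M[R]_(p, q)) (a : 'M[R]_(p, q)) :
  f @ F --> a <-> forall i j, f t i j @[t --> F] --> a i j.
Proof.
split=> [fa i j|fa].
  exact: (continuous_cvg _ (@coord_continuous R p q i j a) fa).
move=> A [P aP PA]; rewrite nbhs_filterE.
suff : \forall t \near F, forall ij, P ij.1 ij.2 (f t ij.1 ij.2).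
  by apply: filterS => t ft; apply: PA => i j; exact: (ft (i, j)).
by apply: filter_forall => ij; apply: fa; exact: aP.
Qed.

Lemma cvg_sumR (I : Type) (r : seq I) (P : pred I) (f : I -> T -> R) (a : I -> R) :
  (forall i, f i @ F --> a i) ->
  \sum_(i <- r | P i) f i t @[t --> F] --> \sum_(i <- r | P i) a i.
Proof.
by move=> fa; apply: cvg_big => // x; apply: add_continuous.
Qed.

Lemma cvg_prodR (I : Type) (r : seq I) (P : pred I) (f : I -> T -> R) (a : I -> R) :
  (forall i, f i @ F --> a i) ->
  \prod_(i <- r | P i) f i t @[t --> F] --> \prod_(i <- r | P i) a i.
Proof.
move=> fa; apply: cvg_big => // x; apply: mul_continuous.
Qed.

Lemma cvg_mulmx p q r (f : T -> 'M[R]_(p, q)) (g : T -> 'M[R]_(q, r))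
    (a : 'M[R]_(p, q)) (b : 'M[R]_(q, r)) :
  f @ F --> a -> g @ F --> b -> f t *m g t @[t --> F] --> a *m b.
Proof.
move=> /cvg_mxP fa /cvg_mxP gb; apply/cvg_mxP => i j; rewrite mxE.
under eq_cvg do rewrite mxE.
by apply: cvg_sumR => k; apply: cvgM.
Qed.

Lemma cvg_trmx p q (f : T -> 'M[R]_(p, q)) (a : 'M[R]_(p, q)) :
  f @ F --> a -> (f t)^T @[t --> F] --> a^T.
Proof.
move=> /cvg_mxP fa; apply/cvg_mxP => i j; rewrite mxE.
under eq_cvg do rewrite mxE; exact: fa.
Qed.

Lemma cvg_det n (f : T -> 'M[R]_n) (a : 'M[R]_n) : f @ F --> a ->
    \det (f t) @[t --> F] --> \det a.
Proof.
move=> /cvg_mxP fa; apply: cvg_sumR => s; apply: cvgM; first exact: cvg_cst.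
by apply: cvg_prodR => i; exact: fa.
Qed.

Lemma near_unitmx n (f : T -> 'M[R]_n) (a : 'M[R]_n) : f @ F --> a ->
    a \in unitmx ->
  \forall t \near F, f t \in unitmx.
Proof.
move=> /cvg_det fa; rewrite unitmxE unitfE => a0.
by apply: filterS (cvgr_neq0 _ fa a0) => t; rewrite unitmxE unitfE.
Qed.

Lemma cvg_invmx n (f : T -> 'M[R]_n) (a : 'M[R]_n) : f @ F --> a -> a \in unitmx ->
  invmx (f t) @[t --> F] --> invmx a.
Proof.
move=> fa ua; have fu := near_unitmx fa ua.
apply: (@cvg_trans _ ((\det (f t))^-1 *: \adj (f t) @[t --> F])).
  apply: near_eq_cvg; apply: filterS fu => t ft.
  by rewrite /invmx ft.
rewrite /invmx ua; apply/cvg_mxP => i j; rewrite mxE.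
under eq_cvg do rewrite mxE; apply: cvgM.
  apply: cvgV (cvg_det fa).
  by move: ua; rewrite unitmxE unitfE.
rewrite mxE; under eq_cvg do rewrite mxE; rewrite /cofactor.
apply: cvgM; first exact: cvg_cst.
apply: cvg_det; apply/cvg_mxP => k l; rewrite !mxE.
under eq_cvg do rewrite !mxE.
by move/cvg_mxP: fa; exact.
Qed.

Lemma cvg_mxdot p q (f g : T -> 'M[R]_(p, q)) (a b : 'M[R]_(p, q)) :
  f @ F --> a -> g @ F --> b -> mxdot (f t) (g t) @[t --> F] --> mxdot a b.
Proof.
move=> fa gb; apply: cvg_sumR => i; apply: (iffLR (cvg_mxP _ _)).
by apply: cvg_mulmx => //; apply: cvg_trmx.
Qed.

(** With S, S' the inverse square roots of M, f t and D = S - S', the identity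
    S D + D S' = M^-1 - (f t)^-1 paired with D gives c |D|^2 <= |D| |M^-1 - (f t)^-1|,
    where c > 0 is a lower bound of S. *)
Lemma cvg_isqrt n (f : T -> 'M[R]_n) (M : 'M[R]_n) : f @ F --> M -> posdef M ->
  (\forall t \near F, posdef (f t)) -> isqrt (f t) @[t --> F] --> isqrt M.
Proof.
move=> fM pM pf.
have [c c0 cle] := posdef_lower (isqrt_posdef pM).
pose A := invmx M; pose err t : 'M[R]_n := A - invmx (f t).
have err0 : mxdot (err t) (err t) @[t --> F] --> (0 : R).
  have e0 : err @ F --> A - A.
    by apply: cvgB; [exact: cvg_cst | apply: cvg_invmx => //; exact: posdef_unit].
  have := cvg_mxdot e0 e0; rewrite subrr.
  by rewrite /mxdot mul0mx mxtrace0.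
apply/cvg_mxP => i j; apply/cvgrPdist_le => e e0.
have ce : 0 < c ^+ 2 * e ^+ 2 by rewrite mulr_gt0 ?exprn_gt0.
apply: filterS2 pf (cvgr_dist_le _ _ err0 _ ce) => t pft.
rewrite sub0r normrN ger0_norm ?mxdot_ge0 // => errt /=.
set S := isqrt M; set S' := isqrt (f t); set D : 'M[R]_n := S - S'.
have -> : S i j - S' i j = D i j by rewrite !mxE.
rewrite -ler_sqr ?nnegrE ?(ltW e0) // -normrX ger0_norm ?sqr_ge0 //.
rewrite -(ler_pM2l (exprn_gt0 2 c0)); apply: le_trans errt.
apply: (@le_trans _ _ (c ^+ 2 * mxdot D D)).
  by rewrite ler_pM2l ?exprn_gt0 // mxdot_ge.
have [->|D0] := eqVneq D 0.
  by rewrite {1}/mxdot mul0mx mxtrace0 mulr0 mxdot_ge0.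
have DD : 0 < mxdot D D by rewrite mxdot_gt0.
rewrite -(ler_pM2l DD); apply: le_trans (mxdot_CS _ _).
rewrite mulrCA -expr2 -exprMn.
have eD : S *m D + D *m S' = err t.
  by rewrite /D mulmxBr mulmxBl !isqrt_sqr // addrA subrK.
have D1 : c * mxdot D D <= mxdot D (err t).
  rewrite -eD [leRHS]mxdotDr; apply: (@le_trans _ _ (mxdot D (S *m D))); last first.
    by rewrite lerDl mxdotC posdef_ge0 //; exact: isqrt_posdef.
  rewrite -[leRHS]mxdot_tr trmx_mul (isqrt_posdef pM).1 [leRHS]mxdotC.
  by rewrite -[mxdot D D]mxdot_tr; exact: cle.
have D2 : 0 <= c * mxdot D D by rewrite mulr_ge0 ?ltW.
by rewrite ler_sqr ?nnegrE //; exact: le_trans D1.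
Qed.

End Limits.

End PositiveDefinite.

(** * Limits in total spaces *)

Lemma cvg_initial (S : choiceType) (Y : topologicalType) (f : S -> Y)
    (T : Type) (F : set_system T) (FF : Filter F)
    (g : T -> initial_topology f) (s : initial_topology f) :
  f (g t) @[t --> F] --> f s -> g @ F --> s.
Proof.
move=> fg A; rewrite nbhsE => -[_ [[B oB <-] Bs] BA].
apply: (@filterS _ F _ (fun t => B (f (g t)))) => [t|]; first exact: BA.
exact: fg (open_nbhs_nbhs (conj oB Bs)).
Qed.

Section Charts.
Variables (R : realType) (X : topologicalType).

(** A chart with its inverse k named and with continuity stated at each point, the
    form in which limits of sections are computed. *)
Definition chart_with (E : vfam R X) p q (U : set X)
    (h : forall x, 'M[R]_(p, q) -> E x) (k : forall x, E x -> 'M[R]_(p, q)) :=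
  [/\ open U, forall x, U x -> linear (h x),
      forall x, U x -> cancel (h x) (k x) /\ cancel (k x) (h x),
      forall z : X * 'M[R]_(p, q), U z.1 ->
        {for z, continuous (fun z : X * 'M[R]_(p, q) => inTot (h z.1 z.2))}
    & forall e : tot E, U (projT1 e) ->
        {for e, continuous (fun e : tot E => k (projT1 e) (projT2 e))}].

Lemma is_chartP (E : vfam R X) p q (U : set X) (h : forall x, 'M[R]_(p, q) -> E x) :
  is_chart U h <-> exists k, chart_with U h k.
Proof.
have oUE : open U -> open [set e : tot E | U (projT1 e)].
  by move=> oU; apply: open_comp oU => e _; exact: tot_proj.
have oUM : open U -> open (U `*` [set: 'M[R]_(p, q)]).
  move=> oU; rewrite (_ : _ `*` _ = fst @^-1` U); last first.
    by apply/seteqP; split=> z //= [].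
  by apply: open_comp oU => z _; exact: cvg_fst.
split.
  case=> oU hl; rewrite continuous_open_subspace; last exact: oUM.
  move=> hc [k [hk]]; rewrite continuous_open_subspace; last exact: oUE.
  move=> kc; exists k; split=> // [z Uz|e Ue]; first by apply: hc; rewrite inE.
  by apply: kc; rewrite inE.
case=> k [oU hl hk hc kc]; split=> //.
  rewrite continuous_open_subspace; last exact: oUM.
  by move=> z; rewrite inE => -[Uz _]; exact: hc.
exists k; split=> //; rewrite continuous_open_subspace; last exact: oUE.
by move=> e; rewrite inE => Ue; exact: kc.
Qed.

Section Limits.
Context {T : Type} {F : set_system T} {FF : Filter F}.

Lemma near_base (b : T -> X) x U : open U -> U x -> b @ F --> x ->
  \forall t \near F, U (b t).
Proof. by move=> oU Ux bx; exact: bx (open_nbhs_nbhs (conj oU Ux)). Qed.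

Lemma cvg_base (E : vfam R X) (b : T -> X) (v : forall t, E (b t)) x (w : E x) :
  inTot (v t) @[t --> F] --> (inTot w : tot E) -> b @ F --> x.
Proof. by move=> vw; apply: cvg_comp vw (@tot_proj _ _ E _). Qed.

Lemma cvg_chart (E : vfam R X) p q U h k (b : T -> X) (v : T -> 'M[R]_(p, q)) x w :
  @chart_with E p q U h k -> U x -> b @ F --> x -> v @ F --> w ->
  inTot (h (b t) (v t)) @[t --> F] --> (inTot (h x w) : tot E).
Proof.
case=> _ _ _ hc _ Ux bx vw.
exact: cvg_comp (cvg_pair bx vw) (hc (x, w) Ux).
Qed.

Lemma cvg_coord (E : vfam R X) p q U h k (b : T -> X) (v : forall t, E (b t)) x
    (w : E x) :
  @chart_with E p q U h k -> U x ->
  inTot (v t) @[t --> F] --> (inTot w : tot E) ->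
  k (b t) (v t) @[t --> F] --> k x w.
Proof. by case=> _ _ _ _ kc Ux vw; apply: cvg_comp vw (kc (inTot w) Ux). Qed.

(** Convergence in the total space is convergence of the base point and of the
    coordinates in one chart. *)
Lemma cvg_of_coord (E : vfam R X) p q U h k (b : T -> X)
    (v : forall t, E (b t)) x (w : E x) :
  @chart_with E p q U h k -> U x -> b @ F --> x ->
  k (b t) (v t) @[t --> F] --> k x w ->
  inTot (v t) @[t --> F] --> (inTot w : tot E).
Proof.
move=> hP Ux bx vw; have [oU _ hk _ _] := hP.
have [_ kK] := hk _ Ux; rewrite -[w]kK.
apply: cvg_trans (cvg_chart hP Ux bx vw).
apply: near_eq_cvg; apply: filterS (near_base oU Ux bx) => t /hk[_ kKt].
by rewrite kKt.
Qed.

Lemma cvg_sumP (E G : vfam R X) (b : T -> X) (v : forall t, sum_fam E G (b t))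
    x (w : sum_fam E G x) :
  inTot (v t) @[t --> F] --> (inTot w : tot (sum_fam E G)) <->
  (inTot (v t).1 @[t --> F] --> (inTot w.1 : tot E)) /\
  (inTot (v t).2 @[t --> F] --> (inTot w.2 : tot G)).
Proof.
split=> [vw|[v1 v2]].
  split; first exact: cvg_comp vw (@sum_top_fst R X E G (inTot w)).
  exact: cvg_comp vw (@sum_top_snd R X E G (inTot w)).
by apply: cvg_initial => /=; exact: cvg_pair v1 v2.
Qed.

Lemma cvg_sumI (E G : vfam R X) (b : T -> X) (v1 : forall t, E (b t))
    (v2 : forall t, G (b t)) x (w1 : E x) (w2 : G x) :
  inTot (v1 t) @[t --> F] --> (inTot w1 : tot E) ->
  inTot (v2 t) @[t --> F] --> (inTot w2 : tot G) ->
  inTot ((v1 t, v2 t) : sum_fam E G (b t)) @[t --> F] -->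
    (inTot ((w1, w2) : sum_fam E G x) : tot (sum_fam E G)).
Proof. by move=> c1 c2; apply/cvg_sumP. Qed.

Lemma cvg_trivP (b : T -> X) (v : T -> R) x (w : R) :
  inTot (v t : triv_fam R X (b t)) @[t --> F] -->
    (inTot (w : triv_fam R X x) : tot (triv_fam R X)) <->
  b @ F --> x /\ v @ F --> w.
Proof.
split=> [vw|[bx vw]]; last by apply: cvg_initial => /=; exact: cvg_pair bx vw.
split; first exact: cvg_base vw.
exact: cvg_comp vw (@triv_val_continuous R X (inTot (w : triv_fam R X x))).
Qed.

Lemma ob_chart m (E : orth_bundle R X m) x : exists U
    (h : forall y, 'M[R]_(1, m) -> E y) k, U x /\ chart_with U h k.
Proof.
by have [U [h [Ux /is_chartP[k hk]]]] := ob_loctriv E x; exists U, h, k.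
Qed.

Lemma cvg_lin m (E : orth_bundle R X m) (b : T -> X) (c : T -> R)
    (v1 v2 : forall t, E (b t)) x (w1 w2 : E x) (d : R) :
  c @ F --> d ->
  inTot (v1 t) @[t --> F] --> (inTot w1 : tot E) ->
  inTot (v2 t) @[t --> F] --> (inTot w2 : tot E) ->
  inTot (c t *: v1 t + v2 t) @[t --> F] --> (inTot (d *: w1 + w2) : tot E).
Proof.
move=> cd vw1 vw2; have [U [h [k [Ux hP]]]] := ob_chart E x.
have bx := cvg_base vw1; have [oU hl hk _ _] := hP.
have kl y a u u' : U y -> k y (a *: u + u') = a *: k y u + k y u'.
  move=> Uy; have [hK kK] := hk _ Uy.
  by rewrite -{1}[u]kK -{1}[u']kK -hl // hK.
apply: (cvg_of_coord hP Ux bx); rewrite kl //.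
apply: (@cvg_trans _ (c t *: k _ (v1 t) + k _ (v2 t) @[t --> F])).
  apply: near_eq_cvg; apply: filterS (near_base oU Ux bx) => t Ut.
  by rewrite kl.
by apply: cvgD; [apply: cvgZ => //|]; exact: cvg_coord hP Ux _.
Qed.

Lemma cvg_ip m (E : orth_bundle R X m) (b : T -> X)
    (v1 v2 : forall t, E (b t)) x (w1 w2 : E x) :
  inTot (v1 t) @[t --> F] --> (inTot w1 : tot E) ->
  inTot (v2 t) @[t --> F] --> (inTot w2 : tot E) ->
  ip (v1 t) (v2 t) @[t --> F] --> ip w1 w2.
Proof.
move=> vw1 vw2.
have : inTot ((v1 t, v2 t) : sum_fam E E (b t)) @[t --> F] -->
   (inTot ((w1, w2) : sum_fam E E x) : tot (sum_fam E E)) by apply/cvg_sumP.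
by move=> vw; exact: cvg_comp vw
  (@ip_continuous R X m E (inTot ((w1, w2) : sum_fam E E x))).
Qed.

End Limits.

End Charts.

(** * Linear maps and inner products *)

Section LinearProp.
Variables (R : realType) (V W : lmodType R) (f : V -> W).
Hypothesis fl : linear f.

Lemma lin0 : f 0 = 0.
Proof. by have := fl (-1) 0 0; rewrite scaler0 addr0 scaleN1r addNr. Qed.

Lemma linZ a u : f (a *: u) = a *: f u.
Proof. by rewrite -[a *: u]addr0 fl lin0 addr0. Qed.

Lemma linD u v : f (u + v) = f u + f v.
Proof. by rewrite -[u]scale1r fl !scale1r. Qed.

Lemma linB u v : f (u - v) = f u - f v.
Proof. by rewrite -scaleN1r linD linZ scaleN1r. Qed.

Lemma lin_sum (I : Type) (r : seq I) (P : pred I) (u : I -> V) :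
  f (\sum_(i <- r | P i) u i) = \sum_(i <- r | P i) f (u i).
Proof. by apply: (big_morph f); [exact: linD | exact: lin0]. Qed.

End LinearProp.

Section InnerProp.
Variables (R : realType) (V : lmodType R) (ip : V -> V -> R).
Hypothesis ipP : is_inner ip.

Lemma inner_linl v : linear (fun u => ip u v : R^o).
Proof. by case: ipP => -[_ + _] _; apply. Qed.

Lemma innerC u v : ip u v = ip v u. Proof. by case: ipP. Qed.

Lemma innerZl a u v : ip (a *: u) v = a * ip u v.
Proof. exact: (linZ (inner_linl v)). Qed.

Lemma innerDl u u' v : ip (u + u') v = ip u v + ip u' v.
Proof. exact: (linD (inner_linl v)). Qed.

Lemma innerZr a u v : ip v (a *: u) = a * ip v u.
Proof. by rewrite innerC innerZl innerC. Qed.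

Lemma innerDr u u' v : ip v (u + u') = ip v u + ip v u'.
Proof. by rewrite innerC innerDl !(innerC v). Qed.

Lemma inner0l v : ip 0 v = 0. Proof. exact: (lin0 (inner_linl v)). Qed.

Lemma inner_suml (I : Type) (r : seq I) (P : pred I) (u : I -> V) v :
  ip (\sum_(i <- r | P i) u i) v = \sum_(i <- r | P i) ip (u i) v.
Proof. exact: (lin_sum (inner_linl v)). Qed.

Lemma inner_sumr (I : Type) (r : seq I) (P : pred I) (u : I -> V) v :
  ip v (\sum_(i <- r | P i) u i) = \sum_(i <- r | P i) ip v (u i).
Proof. by rewrite innerC inner_suml; apply: eq_bigr => i _; rewrite innerC. Qed.

Lemma inner_eq0 u : ip u u = 0 -> u = 0.
Proof.
case: ipP => _ _ pos uu; apply/eqP/negPn/negP => /pos; by rewrite uu ltxx.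
Qed.

Lemma inner_ext u v : (forall w, ip u w = ip v w) -> u = v.
Proof.
move=> uv; apply/eqP; rewrite -subr_eq0; apply/eqP/inner_eq0.
by rewrite innerDl -scaleN1r innerZl uv mulN1r subrr.
Qed.

Definition gram m (h : 'rV[R]_m -> V) : 'M[R]_m :=
  \matrix_(i, j) ip (h (delta_mx 0 i)) (h (delta_mx 0 j)).

Lemma gramE m (h : 'rV[R]_m -> V) v w : linear h ->
  ip (h v) (h w) = mxdot (v *m gram h) w.
Proof.
move=> hl; rewrite mxdotC mxdotE big_ord1.
rewrite [in LHS](row_sum_delta v) [in LHS](row_sum_delta w) !(lin_sum hl).
rewrite inner_sumr; apply: eq_bigr => j _.
rewrite (linZ hl) innerZr; congr (_ * _); rewrite inner_suml mxE.
by apply: eq_bigr => i _; rewrite (linZ hl) innerZl !mxE.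
Qed.

Lemma gram_posdef m (h : 'rV[R]_m -> V) : linear h -> injective h ->
  posdef (gram h).
Proof.
move=> hl hi; split; first by apply/matrixP => i j; rewrite !mxE innerC.
move=> v v0; rewrite -gramE //; case: ipP => _ _; apply.
by apply: contra v0 => /eqP hv; apply/eqP/hi; rewrite hv (lin0 hl).
Qed.

(** The matrix A of the coordinates of the e_i has trivial kernel because the e_i are
    orthonormal, so it is invertible and the e_i span. *)
Lemma orthonormal_basis m (h : 'rV[R]_m -> V) (k : V -> 'rV[R]_m)
    (e : 'I_m -> V) u :
  linear h -> cancel h k -> cancel k h ->
  (forall i j, ip (e i) (e j) = (i == j)%:R) ->
  u = \sum_i ip u (e i) *: e i.
Proof.
move=> hl hK kK eP.
pose A : 'M[R]_m := \matrix_i k (e i).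
have eA i : e i = h (delta_mx 0 i *m A) by rewrite -rowE rowK kK.
have hA v : h (v *m A) = \sum_i v 0 i *: e i.
  rewrite {1}(row_sum_delta v) mulmx_suml (lin_sum hl).
  by apply: eq_bigr => i _; rewrite -scalemxAl (linZ hl) -eA.
have uA : A \in unitmx.
  rewrite -row_free_unit; apply: inj_row_free => v vA.
  apply/rowP => i; rewrite mxE; have := hA v; rewrite vA (lin0 hl).
  move=> /(congr1 (fun u => ip u (e i))); rewrite inner0l inner_suml.
  rewrite (bigD1 i) //= innerZl eP eqxx mulr1 big1 ?addr0 // => j ji.
  by rewrite innerZl eP (negPf ji) mulr0.
have := hA (k u *m invmx A); rewrite mulmxKV // kK => {1}->.
apply: eq_bigr => i _; congr (_ *: _).
have := hA (k u *m invmx A); rewrite mulmxKV // kK => {2}->.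
rewrite inner_suml (bigD1 i) //= innerZl eP eqxx mulr1 big1 ?addr0 // => j ji.
by rewrite innerZl eP (negPf ji) mulr0.
Qed.

End InnerProp.

(** * Orthonormal charts *)

Section ChartOperations.
Variables (R : realType) (X : topologicalType).

Lemma cvg_continuous (A B : topologicalType) (f : A -> B) (a : A) :
  f t @[t --> a] --> f a -> {for a, continuous f}.
Proof. by []. Qed.

Lemma fst_continuous (A B : topologicalType) (z : A * B) : t.1 @[t --> z] --> z.1.
Proof. by case: z => a b; exact: cvg_fst. Qed.

Lemma snd_continuous (A B : topologicalType) (z : A * B) : t.2 @[t --> z] --> z.2.
Proof. by case: z => a b; exact: cvg_snd. Qed.

Lemma chart_mul (E : vfam R X) m (U V : set X) h k (P : X -> 'M[R]_m) :
  @chart_with R X E 1 m U h k -> open V -> V `<=` U ->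
  (forall x, V x -> P x \in unitmx /\ {for x, continuous P}) ->
  @chart_with R X E 1 m V (fun x v => h x (v *m P x))
    (fun x e => k x e *m invmx (P x)).
Proof.
move=> hP oV VU VP; have [oU hl hk _ kc] := hP; split.
- exact: oV.
- by move=> x Vx a u v; rewrite mulmxDl -scalemxAl hl //; exact: VU.
- move=> x Vx; have [hK kK] := hk x (VU _ Vx); have [Pu _] := VP x Vx.
  by split=> [v|e]; [rewrite hK mulmxK | rewrite mulmxKV // kK].
- move=> z Vx; apply: cvg_continuous; have [_ Pc] := VP _ Vx.
  apply: (cvg_chart hP (VU _ Vx)); first exact: fst_continuous.
  apply: cvg_mulmx; first exact: snd_continuous.
  exact: (@cvg_comp _ _ _ fst P _ _ _ (@fst_continuous _ _ z) Pc).
- move=> e Vx; apply: cvg_continuous; have [Pu Pc] := VP _ Vx.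
  apply: cvg_mulmx; first exact: (kc e (VU _ Vx)).
  apply: (@cvg_invmx R _ _ _ m (fun t : tot E => P (projT1 t))).
    exact: cvg_comp (@tot_proj _ _ E e) Pc.
  exact: Pu.
Qed.

Lemma cvg_mxvec T (F : set_system T) (FF : Filter F) p q (f : T -> 'M[R]_(p, q))
    (a : 'M[R]_(p, q)) :
  f @ F --> a -> mxvec (f t) @[t --> F] --> mxvec a.
Proof.
move=> /cvg_mxP fa; apply/cvg_mxP => i j; rewrite !ord1.
case/mxvec_indexP: j => k l; rewrite mxvecE.
by under eq_cvg do rewrite mxvecE; exact: fa.
Qed.

Lemma cvg_vec_mx T (F : set_system T) (FF : Filter F) p q (f : T -> 'rV[R]_(p * q))
    (a : 'rV[R]_(p * q)) :
  f @ F --> a -> (vec_mx (f t) : 'M[R]_(p, q)) @[t --> F] -->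
    (vec_mx a : 'M[R]_(p, q)).
Proof.
move=> /cvg_mxP fa; apply/cvg_mxP => i j; rewrite mxE.
by under eq_cvg do rewrite mxE; exact: fa.
Qed.

Lemma chart_mxvec (E : vfam R X) p q (U : set X) h k :
  @chart_with R X E 1 (p * q) U h k ->
  @chart_with R X E p q U (fun x v => h x (mxvec v)) (fun x e => vec_mx (k x e)).
Proof.
move=> hP; have [oU hl hk _ _] := hP; split; first exact: oU.
- by move=> x Ux a u v; rewrite linearD linearZ /= hl.
- move=> x Ux; have [hK kK] := hk x Ux.
  by split=> [v|e]; rewrite ?hK ?mxvecK // vec_mxK kK.
- move=> z Ux; apply: cvg_continuous.
  apply: (cvg_chart hP Ux); first exact: fst_continuous.
  by apply: cvg_mxvec; exact: snd_continuous.
- move=> e Ux; apply: cvg_continuous; apply: cvg_vec_mx.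
  by have [_ _ _ _ kc] := hP; exact: (kc e Ux).
Qed.

(** Multiplication by the inverse square root of the Gram matrix orthonormalises a
    chart, and it depends continuously on the base point. *)
Lemma isometric_chart m (E : orth_bundle R X m) x : exists U
    (h : forall y, 'rV[R]_m -> E y) k, [/\ U x, chart_with U h k &
    forall y, U y -> forall v w, ip (h y v) (h y w) = mxdot v w].
Proof.
have [U [h [k [Ux hP]]]] := ob_chart E x; have [oU hl hk _ _] := hP.
pose M y := gram (@ip _ _ _ E y) (h y).
have pM y : U y -> posdef (M y).
  by move=> Uy; refine (gram_posdef (ip_inner E y) (hl _ Uy) (can_inj (hk _ Uy).1)).
have Mc y : U y -> {for y, continuous M}.
  move=> Uy; apply: cvg_continuous; apply/cvg_mxP => i j; rewrite mxE.
  under eq_cvg do rewrite mxE.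
  by apply: cvg_ip; apply: (cvg_chart hP Uy) => //; exact: cvg_cst.
have pI y (Uy : U y) := isqrtP (pM y Uy).
exists U, (fun y v => h y (v *m isqrt (M y))),
  (fun y e => k y e *m invmx (isqrt (M y))).
split; first exact: Ux.
  apply: (chart_mul hP oU) => [//|y Uy]; split; first exact/posdef_unit/(pI _ Uy).1.
  apply: cvg_isqrt; [exact: Mc|exact: pM|].
  by apply: filterS (near_base oU Uy cvg_id) => z; exact: pM.
move=> y Uy v w; rewrite (gramE (ip_inner E y)) ?hl //; last exact: hl.
have [[Is _] IMI] := pI _ Uy.
by rewrite mxdot_mulr Is -!mulmxA (mulmxA (isqrt _)) IMI mulmx1.
Qed.

End ChartOperations.

(** * Quaternions *)

Section Quaternions.
Variable R : realType.
Implicit Types (r s t : quat R) (u v w : 'rV[R]_3).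

Lemma rV3P u v : u 0 0 = v 0 0 -> u 0 1 = v 0 1 -> u 0 2 = v 0 2 -> u = v.
Proof.
move=> e0 e1 e2; apply/rowP => -[[|[|[|//]]] lt3].
- by rewrite (_ : Ordinal lt3 = 0) //; apply: val_inj.
- by rewrite (_ : Ordinal lt3 = 1) //; apply: val_inj.
- by rewrite (_ : Ordinal lt3 = 2) //; apply: val_inj.
Qed.

Lemma sum_ord3 (V : nmodType) (F : 'I_3 -> V) : \sum_i F i = F 0 + F 1 + F 2.
Proof.
rewrite 2!big_ord_recr big_ord1 /=.
by congr (F _ + F _ + F _); apply: val_inj.
Qed.

Lemma mxdot3E u v : mxdot u v = u 0 0 * v 0 0 + u 0 1 * v 0 1 + u 0 2 * v 0 2.
Proof. by rewrite mxdotE big_ord1 sum_ord3. Qed.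

Lemma cross3E u v :
  (cross3 u v 0 0 = u 0 1 * v 0 2 - u 0 2 * v 0 1) *
  (cross3 u v 0 1 = u 0 2 * v 0 0 - u 0 0 * v 0 2) *
  (cross3 u v 0 2 = u 0 0 * v 0 1 - u 0 1 * v 0 0).
Proof.
have e : (((0 + 1 : 'I_3) = 1) * ((0 + 2 : 'I_3) = 2)) *
         (((1 + 1 : 'I_3) = 2) * ((1 + 2 : 'I_3) = 0)) *
         (((2 + 1 : 'I_3) = 0) * ((2 + 2 : 'I_3) = 1)).
  by do !split; apply: val_inj.
by rewrite !mxE !e.
Qed.

Definition qdot r s : R := r.1 * s.1 + mxdot r.2 s.2.

Lemma quatP r s : r.1 = s.1 -> r.2 0 0 = s.2 0 0 -> r.2 0 1 = s.2 0 1 ->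
  r.2 0 2 = s.2 0 2 -> r = s.
Proof.
by case: r s => [r1 r2] [s1 s2] /= -> e0 e1 e2; rewrite (rV3P e0 e1 e2).
Qed.

Lemma qmulE r s : qmul r s =
  (r.1 * s.1 - mxdot r.2 s.2, r.1 *: s.2 + s.1 *: r.2 + cross3 r.2 s.2).
Proof. by []. Qed.

Lemma qmulA r s t : qmul (qmul r s) t = qmul r (qmul s t).
Proof.
by apply: quatP; rewrite !qmulE /= ?mxdot3E ?(cross3E, mxE) ?mxdot3E; ring.
Qed.

Lemma qmul1l r : qmul (qone R) r = r.
Proof. by apply: quatP; rewrite !qmulE /= ?mxdot3E ?(cross3E, mxE) /=; ring. Qed.

Lemma qmul1r r : qmul r (qone R) = r.
Proof. by apply: quatP; rewrite !qmulE /= ?mxdot3E ?(cross3E, mxE) /=; ring. Qed.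

Lemma qmul_linl s : linear (fun r => qmul r s).
Proof.
move=> a r r'; apply: quatP; rewrite !qmulE /= ?mxdot3E ?(cross3E, mxE) /=
  ?mxdot3E ?mxE;
rewrite /GRing.scale /=; ring.
Qed.

Lemma qmul_linr s : linear (qmul s).
Proof.
move=> a r r'; apply: quatP; rewrite !qmulE /= ?mxdot3E ?(cross3E, mxE) /=
  ?mxdot3E ?mxE;
rewrite /GRing.scale /=; ring.
Qed.

Lemma qdot_mull r s t : qdot (qmul r s) (qmul r t) = qdot r r * qdot s t.
Proof. by rewrite /qdot !qmulE /= !mxdot3E ?(cross3E, mxE); ring. Qed.

Lemma qdot_mulr r s t : qdot (qmul s r) (qmul t r) = qdot r r * qdot s t.
Proof. by rewrite /qdot !qmulE /= !mxdot3E ?(cross3E, mxE); ring. Qed.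

Lemma qdotC r s : qdot r s = qdot s r.
Proof. by rewrite /qdot mulrC mxdotC. Qed.

Lemma qdot_linl s : linear (fun r => qdot r s : R^o).
Proof.
move=> a r r'; rewrite /qdot /= mxdotDl mxdotZl /GRing.scale /=; ring.
Qed.

Lemma qdot_eq0 r : qdot r r = 0 -> r = 0.
Proof.
move/eqP; rewrite paddr_eq0 ?mxdot_ge0 -?expr2 ?sqr_ge0 // sqrf_eq0 mxdot_eq0.
by case: r => a b /= /andP[/eqP -> /eqP ->].
Qed.

Definition qconj r : quat R := (r.1, - r.2).

Lemma qmul_conj r : qmul (qconj r) r = (qdot r r, 0).
Proof.
by apply: quatP; rewrite !qmulE /= /qdot ?mxdot3E ?(cross3E, mxE); ring.
Qed.

Lemma qmulVr r : r != 0 -> qmul ((qdot r r)^-1 *: qconj r) r = qone R.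
Proof.
move=> r0; rewrite (linZ (qmul_linl r)) qmul_conj /qone.
congr pair; last by rewrite /= scaler0.
by rewrite /= [LHS]mulVf //; apply: contra r0 => /eqP/qdot_eq0 ->.
Qed.

Lemma quat_of_rowK : cancel (@quat_of_row R) (@row_of_quat R).
Proof.
move=> v; apply/rowP => j; rewrite mxE; case: splitP => i /= ji.
  by rewrite !mxE ord1 eqxx mulr1n; congr (v _ _); apply: val_inj;
    rewrite /= ji ord1.
by rewrite !mxE; congr (v _ _); apply: val_inj.
Qed.

Lemma row_of_quatK : cancel (@row_of_quat R) (@quat_of_row R).
Proof.
case=> a v; rewrite /quat_of_row /row_of_quat /=; congr pair; last exact: row_mxKr.
have e : (0 : 'I_(1 + 3)) = lshift 3 (0 : 'I_1) by exact: val_inj.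
rewrite [X in fun_of_matrix _ _ X]e.
by apply: (etrans (@row_mxEl R 1 1 3 a%:M v 0 0)); rewrite mxE eqxx mulr1n.
Qed.

Lemma quat_of_row_linear : linear (@quat_of_row R).
Proof.
move=> a v w; rewrite /quat_of_row !mxE; congr pair.
by rewrite linearD linearZ.
Qed.

Lemma row_of_quat_linear : linear (@row_of_quat R).
Proof.
move=> a r s; apply: (can_inj quat_of_rowK).
by rewrite quat_of_row_linear !row_of_quatK.
Qed.

Lemma mxdot_row_of_quat r s : mxdot (row_of_quat r) (row_of_quat s) = qdot r s.
Proof.
rewrite -[LHS]/(\tr (@row_mx R 1 1 3 r.1%:M r.2 *m (@row_mx R 1 1 3 s.1%:M s.2)^T)).
rewrite tr_row_mx mul_row_col mxtraceD; congr (_ + _).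
by rewrite tr_scalar_mx -scalar_mxM mxtrace_scalar.
Qed.

Lemma row_qscale n r (v : 'M[R]_(n, 4)) l :
  quat_of_row (row l (qscale r v)) = qmul r (quat_of_row (row l v)).
Proof. by rewrite rowK row_of_quatK. Qed.

Lemma qrows_ext n (v w : 'M[R]_(n, 4)) :
  (forall l, quat_of_row (row l v) = quat_of_row (row l w)) -> v = w.
Proof. by move=> vw; apply/row_matrixP => l; apply/(can_inj quat_of_rowK)/vw. Qed.

Lemma qrow_linear n l : linear (fun v : 'M[R]_(n, 4) => quat_of_row (row l v)).
Proof. by move=> a v w; rewrite linearD linearZ quat_of_row_linear. Qed.

Lemma qscaleA n r s (v : 'M[R]_(n, 4)) : qscale (qmul r s) v =
    qscale r (qscale s v).
Proof. by apply: qrows_ext => l; rewrite !row_qscale qmulA. Qed.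

Lemma qscale1 n (v : 'M[R]_(n, 4)) : qscale (qone R) v = v.
Proof. by apply: qrows_ext => l; rewrite row_qscale qmul1l. Qed.

Lemma qscale_linl n (v : 'M[R]_(n, 4)) : linear (fun r => qscale r v).
Proof.
move=> a r s; apply: qrows_ext => l.
by rewrite qrow_linear !row_qscale (qmul_linl _ a).
Qed.

Lemma qscale_linr n r : linear (@qscale R n r).
Proof.
move=> a v w; apply: qrows_ext => l.
by rewrite qrow_linear !row_qscale qrow_linear (qmul_linr _ a).
Qed.

Lemma mxdot_qscale n r (v w : 'M[R]_(n, 4)) :
  mxdot (qscale r v) (qscale r w) = qdot r r * mxdot v w.
Proof.
rewrite !(mxdot_row _ w) mxdot_row mulr_sumr; apply: eq_bigr => l _.
rewrite !rowK mxdot_row_of_quat qdot_mull; congr (_ * _).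
by rewrite -mxdot_row_of_quat !quat_of_rowK.
Qed.

Definition qbase (b : 'I_4) : quat R := quat_of_row (delta_mx 0 b).

Lemma qbaseE r : r = \sum_b row_of_quat r 0 b *: qbase b.
Proof.
rewrite -[LHS]row_of_quatK {1}(row_sum_delta (row_of_quat r)).
rewrite (lin_sum quat_of_row_linear); apply: eq_bigr => b _.
by rewrite (linZ quat_of_row_linear).
Qed.

Lemma qdot_base b c : qdot (qbase b) (qbase c) = (b == c)%:R.
Proof.
by rewrite -mxdot_row_of_quat !quat_of_rowK /mxdot trmx_delta mul_delta_mx_cond
  trace_mx11 mulmxnE mxE !eqxx.
Qed.

(** The trace of a bilinear form on H is the same in all orthonormal bases. It is
    used for the bases that arise from right multiplication by a unit quaternion
    and from an automorphism of H. *)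
Lemma qtrace (kappa : quat R -> quat R) (B : quat R -> quat R -> R) :
  linear kappa -> (forall r s, qdot (kappa r) (kappa s) = qdot r s) ->
  (forall s, linear (fun r => B r s : R^o)) ->
    (forall r, linear (B r : _ -> R^o)) ->
  \sum_b B (kappa (qbase b)) (kappa (qbase b)) = \sum_b B (qbase b) (qbase b).
Proof.
move=> kl kd Bl Br.
pose O : 'M[R]_4 := \matrix_b row_of_quat (kappa (qbase b)).
have OO : O^T *m O = 1%:M.
  apply: mulmx1C; apply/matrixP => b c.
  have := kd (qbase b) (qbase c); rewrite qdot_base -mxdot_row_of_quat.
  rewrite !mxE => <-; rewrite mxdotE big_ord1; apply: eq_bigr => d _.
  by rewrite !mxE.
have kE b : kappa (qbase b) = \sum_c O b c *: qbase c.
  by rewrite {1}[kappa _]qbaseE; apply: eq_bigr => c _; rewrite [in RHS]mxE.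
clearbody O.
transitivity (\sum_b \sum_c \sum_d O b c * O b d * B (qbase c) (qbase d)).
  apply: eq_bigr => b _; rewrite {1}kE (lin_sum (Bl _)); apply: eq_bigr => c _.
  rewrite (linZ (Bl _)) kE (lin_sum (Br _)) scaler_sumr; apply: eq_bigr => d _.
  by rewrite (linZ (Br _)) /GRing.scale /= mulrA.
rewrite exchange_big; apply: eq_bigr => c _ /=.
rewrite exchange_big (bigD1 c) //= -mulr_suml [X in _ + X]big1 => [|d dc].
  rewrite addr0 (_ : \sum_i _ = 1) ?mul1r //.
  have /matrixP/(_ c c) := OO; rewrite !mxE eqxx => oc; rewrite -[RHS]oc.
  by apply: eq_bigr => b _; rewrite mxE.
rewrite -mulr_suml (_ : \sum_i _ = 0) ?mul0r //.
have /matrixP/(_ c d) := OO; rewrite !mxE eq_sym (negPf dc) => oc; rewrite -[RHS]oc.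
by apply: eq_bigr => b _; rewrite mxE.
Qed.

(** A quaternion is imaginary exactly when its square is a nonpositive real number,
    and that number is then minus its squared norm; an automorphism preserves
    squares and real numbers. *)
Lemma alg_aut_isom (kappa : quat R -> quat R) :
  is_alg_aut (qone R) (@qmul R) kappa ->
  forall r s, qdot (kappa r) (kappa s) = qdot r s.
Proof.
case=> kl _ k1 kM.
have sq s : qmul s s = (s.1 * s.1 - mxdot s.2 s.2, (2 * s.1) *: s.2).
  apply: quatP; rewrite !qmulE /= ?mxdot3E ?(cross3E, mxE); ring.
have kreal a : kappa (a, 0) = (a, 0).
  have -> : (a, 0) = a *: qone R by congr pair; rewrite /= ?scaler0 // [RHS]mulr1.
  by rewrite (linZ kl) k1.
have kim u : (kappa (0, u)).1 = 0 /\
    mxdot (kappa (0, u)).2 (kappa (0, u)).2 = mxdot u u.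
  have := kM (0, u) (0, u); rewrite !sq /= mulr0 sub0r mulr0 scale0r kreal.
  case: (kappa (0, u)) => a v /= [].
  have [->|v0] := eqVneq v 0; last first.
    move=> e /esym/eqP; rewrite scaler_eq0 (negPf v0) orbF mulf_eq0 pnatr_eq0 /=.
    by move=> /eqP a0; move: e; rewrite a0 mulr0 sub0r => /oppr_inj.
  rewrite {2}/mxdot mul0mx mxtrace0 subr0 => e _.
  have u0 : mxdot u u = 0.
    by apply/eqP; rewrite eq_le mxdot_ge0 andbT -oppr_ge0 e -expr2 sqr_ge0.
  rewrite u0 /mxdot mul0mx mxtrace0; split=> //.
  by apply/eqP; rewrite -sqrf_eq0 expr2 -e u0 oppr0.
have kn r : qdot (kappa r) (kappa r) = qdot r r.
  case: r => a u; have -> : (a, u) = (a, 0) + (0, u) :> quat R.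
    by congr pair; rewrite /= ?addr0 ?add0r.
  rewrite (linD kl) kreal; have [] := kim u.
  case: (kappa (0, u)) => b v /= -> e.
  by rewrite /qdot /= !add0r e !addr0.
move=> r s; have := kn (r + s); rewrite (linD kl).
have D a b : qdot (a + b) (a + b) = qdot a a + qdot b b + 2 * qdot a b.
  rewrite (linD (qdot_linl _)) !(qdotC _ (a + b)) !(linD (qdot_linl _)) (qdotC b a).
  ring.
by rewrite !D !kn => /addrI /mulfI; apply; rewrite pnatr_eq0.
Qed.

End Quaternions.

(** * Frames of H_lambda *)

Section Frames.
Variables (R : realType) (X : topologicalType).
Variables (delta : orth_bundle R X 1) (lam : C_line delta).

Definition lam_mul x (a : delta x) (v : lam x) : lam x := cl_act (0, a) v.

Lemma cl_act_linl x (v : lam x) :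
  linear (fun z : sum_fam (triv_fam R X) delta x => cl_act z v).
Proof. by have [[_ +] _ _] := cl_module lam x; apply. Qed.

Lemma cl_act_linr x (z : sum_fam (triv_fam R X) delta x) :
  linear (fun v : lam x => cl_act z v).
Proof. by have [[+ _] _ _] := cl_module lam x; apply. Qed.

Lemma cl_actE x (s : R) (a : delta x) (v : lam x) :
  cl_act (s, a) v = s *: v + lam_mul a v :> lam x.
Proof.
have [_ one _] := cl_module lam x.
have -> : (s, a) = s *: ((1, 0) : sum_fam (triv_fam R X) delta x) + (0, a).
  congr pair; first by rewrite /= addr0; exact/esym/mulr1.
  by rewrite /= scaler0 add0r.
by rewrite (cl_act_linl v) one.
Qed.

Lemma lam_mulZ x (c : R) (a : delta x) (v : lam x) :
  lam_mul (c *: a) v = c *: lam_mul a v.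
Proof.
rewrite /lam_mul -(linZ (cl_act_linl v)); congr (cl_act _ v).
by congr pair; rewrite /= scaler0.
Qed.

Lemma lam_mulK x (a : delta x) (v : lam x) : ip a a = 1 ->
  lam_mul a (lam_mul a v) = - v.
Proof.
move=> aa; have [_ _ mul] := cl_module lam x.
rewrite /lam_mul -mul /cplx_mul /= !scale0r !mul0r add0r aa addr0.
rewrite cl_actE scaleN1r /lam_mul.
by rewrite (lin0 (cl_act_linl v)) addr0.
Qed.

(** The isometry condition for 1 + a and for a shows that u is orthogonal to a u for
    every u; polarisation of this is skewness. *)
Lemma lam_mul_skew x (a : delta x) (v w : lam x) :
  ip (lam_mul a v) w = - ip v (lam_mul a w).
Proof.
have iP := ip_inner lam x.
have sq u : ip u (lam_mul a u) = 0.
  have := cl_isometric (1, a) u; have := cl_isometric (0, a) u.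
  rewrite /= -/(lam_mul a u) cl_actE scale1r expr0n expr1n add0r => e.
  rewrite !(innerDl iP) !(innerDr iP) e mulrDl mul1r -addrA => /addrI.
  rewrite addrA -{2}[_ * _]add0r => /addIr;
    rewrite [X in _ + X = _ -> _](innerC iP).
  by rewrite -mulr2n => /eqP; rewrite mulrn_eq0 => /eqP.
have := sq (v + w); rewrite /lam_mul (linD (cl_act_linr _)) -!/(lam_mul _ _).
rewrite !(innerDl iP) !(innerDr iP) !sq add0r addr0 => /eqP.
by rewrite addrC addr_eq0 (innerC iP) => /eqP.
Qed.

Section Frame.
Variables (x : X) (a : delta x) (f : lam x).
Hypotheses (aa : ip a a = 1) (ff : ip f f = 1).
Let dP := ip_inner delta x.
Let lP := ip_inner lam x.

Lemma frame_ortho : (ip f (lam_mul a f) = 0) * (ip (lam_mul a f) f = 0) *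
  (ip (lam_mul a f) (lam_mul a f) = 1).
Proof.
have f0 : ip f (lam_mul a f) = 0.
  have := lam_mul_skew a f f; rewrite (innerC lP) => /eqP.
  by rewrite -addr_eq0 -mulr2n mulrn_eq0 /= => /eqP.
split; first by split=> //; rewrite (innerC lP).
by rewrite lam_mul_skew lam_mulK // -scaleN1r (innerZr lP) ff mulr1 opprK.
Qed.

Definition frame_im (u : 'rV[R]_3) : im_fam lam x :=
  (u 0 0 *: a, u 0 1 *: f + u 0 2 *: lam_mul a f).

(** Unit vectors a of delta and f of lambda give the orthonormal basis (a, f, a f) of
    delta + lambda and hence an isomorphism of algebras from H to H_lambda. *)
Definition frame (r : quat R) : H_fam lam x := (r.1, frame_im r.2).

Definition frame_im_inv (w : im_fam lam x) : 'rV[R]_3 :=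
  \row_i [:: ip w.1 a; ip w.2 f; ip w.2 (lam_mul a f)]`_i.

Definition frame_inv (p : H_fam lam x) : quat R := (p.1, frame_im_inv p.2).

Lemma frame_imK : cancel frame_im frame_im_inv.
Proof.
move=> u; have [[f1 f2] f3] := frame_ortho.
apply: rV3P; rewrite !mxE /= ?(innerDl lP) ?(innerDl dP) ?(innerZl lP)
  ?(innerZl dP) ?aa ?ff ?f1 ?f2 ?f3; ring.
Qed.

Lemma delta_span (y : delta x) : y = ip y a *: a.
Proof.
have [U [h [k [Ux [_ hl hk _ _]]]]] := ob_chart delta x.
rewrite {1}(orthonormal_basis dP (e := fun=> a) y (hl _ Ux) (hk _ Ux).1
  (hk _ Ux).2).
  by rewrite big_ord1.
by move=> i j; rewrite !ord1 aa.
Qed.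

Lemma lam_span (w : lam x) : w = ip w f *: f + ip w (lam_mul a f) *: lam_mul a f.
Proof.
have [U [h [k [Ux [_ hl hk _ _]]]]] := ob_chart lam x.
have [[f1 f2] f3] := frame_ortho.
pose e (i : 'I_2) := if i == 0 then f else lam_mul a f.
rewrite {1}(orthonormal_basis lP (e := e) w (hl _ Ux) (hk _ Ux).1 (hk _ Ux).2).
  by rewrite big_ord_recl big_ord1.
by move=> [[|[|//]] i2] [[|[|//]] j2]; rewrite /e /= ?ff ?f1 ?f2 ?f3.
Qed.

Lemma frame_im_invK : cancel frame_im_inv frame_im.
Proof.
case=> y w; rewrite /frame_im !mxE /=; congr pair; first by rewrite -delta_span.
by rewrite -lam_span.
Qed.

Lemma frameK : cancel frame frame_inv.
Proof. by case=> s u; rewrite /frame_inv /= frame_imK. Qed.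

Lemma frame_invK : cancel frame_inv frame.
Proof. by case=> s w; rewrite /frame /= frame_im_invK. Qed.

Lemma frame_im_linear : linear frame_im.
Proof.
move=> c u v; rewrite /frame_im !mxE; congr pair; rewrite /=.
  by rewrite scalerDl scalerA.
rewrite !scalerDl !scalerDr !scalerA -!addrA; congr (_ + _).
by rewrite addrCA.
Qed.

Lemma frame_linear : linear frame.
Proof. by move=> c r s; rewrite /frame frame_im_linear. Qed.

Lemma frame_im_ip u v : im_ip (frame_im u) (frame_im v) = mxdot u v.
Proof.
have [[f1 f2] f3] := frame_ortho.
rewrite /im_ip /ip_sum /= (innerZl dP) (innerZr dP) aa.
rewrite !(innerDl lP) !(innerDr lP) !(innerZl lP) !(innerZr lP) f1 f2 f3 ff.
by rewrite mxdot3E; ring.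
Qed.

Lemma im_ip_inner : is_inner (@im_ip _ _ delta lam x).
Proof.
split=> [|u v|u u0]; rewrite /im_ip /ip_sum.
- split=> [u c v w|v c u w] /=.
    rewrite !(innerDr dP) !(innerDr lP) !(innerZr dP) !(innerZr lP).
    by rewrite /GRing.scale /=; ring.
  rewrite !(innerDl dP) !(innerDl lP) !(innerZl dP) !(innerZl lP).
  by rewrite /GRing.scale /=; ring.
- by rewrite (innerC dP) (innerC lP).
- rewrite -[u]frame_im_invK in u0 *.
  rewrite -/(ip_sum _ _ _ _) -/(im_ip _ _) frame_im_ip mxdot_gt0.
  apply: contra u0 => /eqP ->; apply/eqP; exact: (lin0 frame_im_linear).
Qed.

(** The orientation of Lambda^2 lambda + lambda makes (a, f, a f) positive, so the
    product of a and f in H_lambda is a f. Both sides are compared with an arbitrary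
    vector w, because the cross product is only known through its pairings. *)
Lemma frame_im_cross u v : im_cross (frame_im u) (frame_im v) =
    frame_im (cross3 u v).
Proof.
apply: (inner_ext im_ip_inner) => w; rewrite im_crossP -[w]frame_im_invK.
move: (frame_im_inv w) => {}w; rewrite frame_im_ip /im_vol /= -!/(lam_mul _ _).
have [[f1 f2] f3] := frame_ortho.
have Jf : lam_mul a (lam_mul a f) = -1 *: f by rewrite lam_mulK // scaleN1r.
rewrite !lam_mulZ /lam_mul !(linD (cl_act_linr _)) !(linZ (cl_act_linr _))
  -!/(lam_mul _ _).
rewrite Jf.
rewrite !((innerDl lP), (innerDr lP), (innerZl lP), (innerZr lP)) f1 f2 f3 ff.
by rewrite mxdot3E !cross3E; ring.
Qed.

Lemma frameM r s : frame (qmul r s) = H_mul (frame r) (frame s).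
Proof.
rewrite /H_mul /quat_mul /frame qmulE /= frame_im_ip frame_im_cross.
by rewrite (linD frame_im_linear) frame_im_linear (linZ frame_im_linear).
Qed.

Lemma frame1 : frame (qone R) = (1, 0).
Proof. by rewrite /frame /= (lin0 frame_im_linear). Qed.

End Frame.

End Frames.

(** * Averaging and polar decomposition *)

Section Pointwise.
Variable R : realType.

Definition mxlin p q (f : 'rV[R]_p -> 'rV[R]_q) : 'M[R]_(p, q) :=
  \matrix_i f (delta_mx 0 i).

Lemma mul_mxlin p q (f : 'rV[R]_p -> 'rV[R]_q) v : linear f -> v *m mxlin f = f v.
Proof.
move=> fl; rewrite {2}(row_sum_delta v) (lin_sum fl)
  {1}(row_sum_delta v) mulmx_suml.
by apply: eq_bigr => i _; rewrite (linZ fl) -scalemxAl -rowE rowK.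
Qed.

Lemma mxdot_ext m (A B : 'M[R]_m) :
  (forall v w : 'rV[R]_m, mxdot (v *m A) w = mxdot (v *m B) w) -> A = B.
Proof.
move=> AB; apply/row_matrixP => i; rewrite !rowE.
apply/eqP; rewrite -subr_eq0 -mxdot_eq0 -mulmxBr.
by rewrite {1}mulmxBr -scaleN1r mxdotDl mxdotZl AB mulN1r subrr.
Qed.

Lemma mxdot_mxvec p q (v w : 'M[R]_(p, q)) : mxdot (mxvec v) (mxvec w) = mxdot v w.
Proof.
rewrite !mxdotE big_ord1 pair_big /= (reindex _ (curry_mxvec_bij _ _)) /=.
by apply: eq_bigr => -[i j] _ /=; rewrite !mxvecE.
Qed.

Variable n : nat.
Local Notation N := (n * 4)%N.

Definition qvec (r : quat R) (v : 'rV[R]_N) : 'rV[R]_N :=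
  mxvec (qscale r (vec_mx v)).

Lemma qvec_linl v : linear (fun r => qvec r v).
Proof. by move=> a r s; rewrite /qvec qscale_linl linearD linearZ. Qed.

Lemma qvec_linr r : linear (qvec r).
Proof.
by move=> a v w; rewrite /qvec linearD linearZ qscale_linr linearD linearZ.
Qed.

Lemma mxdot_qvec r v w : mxdot (qvec r v) (qvec r w) = qdot r r * mxdot v w.
Proof. by rewrite mxdot_mxvec mxdot_qscale -mxdot_mxvec !vec_mxK. Qed.

Section Average.
Variables (V : lmodType R) (ip : V -> V -> R) (ipP : is_inner ip).

Section Action.
Variables (A : quat R -> V -> V) (AP : is_left_module (qone R) (@qmul R) A).

Lemma act_linl u : linear (fun r => A r u).
Proof. by have [[_ +] _ _] := AP; apply. Qed.

Lemma act_linr r : linear (A r).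
Proof. by have [[+ _] _ _] := AP; apply. Qed.

(** Up to a factor, the average of the inner product over the unit quaternions: the
    trace over H of the form (r, s) |-> ip (A r u) (A s v). *)
Definition qavg (u v : V) : R := \sum_b ip (A (qbase R b) u) (A (qbase R b) v).

Lemma qavg_sub (kappa : quat R -> quat R) u v :
  linear kappa -> (forall r s, qdot (kappa r) (kappa s) = qdot r s) ->
  \sum_b ip (A (kappa (qbase R b)) u) (A (kappa (qbase R b)) v) = qavg u v.
Proof.
move=> kl kd; apply: (qtrace (B := fun r s => ip (A r u) (A s v))) => // r.
  move=> a s t; rewrite act_linl (inner_linl ipP); exact: erefl.
by move=> a s t; rewrite act_linl (innerDr ipP) (innerZr ipP).
Qed.

(** Right multiplication by a unit quaternion is orthogonal, so it does not change the
    trace. *)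
Lemma qavg_inv r u v : qdot r r = 1 -> qavg (A r u) (A r v) = qavg u v.
Proof.
move=> r1; have [_ _ AM] := AP.
rewrite -[RHS](@qavg_sub (fun s => qmul s r)); first last.
- by move=> s t; rewrite qdot_mulr r1 mul1r.
- exact: qmul_linl.
by apply: eq_bigr => b _; rewrite !AM.
Qed.

Lemma qavg_inner : is_inner qavg.
Proof.
split=> [|u v|u u0]; rewrite /qavg.
- split=> [u c v w|v c u w]; rewrite /GRing.scale /= mulr_sumr -big_split;
    apply: eq_bigr => b _ /=.
    by rewrite act_linr (innerDr ipP) (innerZr ipP).
  by rewrite act_linr (innerDl ipP) (innerZl ipP).
- by apply: eq_bigr => b _; rewrite (innerC ipP).
- have [_ _ pos] := ipP; have [_ one AM] := AP.
  have nz b : A (qbase R b) u != 0.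
    apply: contra u0 => /eqP Au.
    have b0 : qbase R b != 0.
      apply/eqP => b0; have := qdot_base R b b.
      by rewrite b0 (lin0 (qdot_linl _)) eqxx => /eqP; rewrite eq_sym oner_eq0.
    by rewrite -[u]one -(qmulVr b0) AM Au (lin0 (act_linr _)).
  rewrite (bigD1 ord0) //= ltr_pwDl ?pos //.
  by apply: sumr_ge0 => b _; rewrite ltW // pos.
Qed.

Section Normalise.
Variables (F : 'rV[R]_N -> V) (Fl : linear F) (Fi : injective F).
Hypothesis FA : forall r v, F (qvec r v) = A r (F v).

(** Composition with the first factor makes F an isometry for the averaged inner
    product and keeps it H-linear; the second factor, the polar part, then makes it
    an isometry for the given one. The polar part need not be H-linear, but the second
    factors of two frames are conjugate under the transition between them. *)
Definition avg_factor := isqrt (gram qavg F).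

Lemma avg_posdef : posdef (gram qavg F).
Proof. exact (gram_posdef qavg_inner Fl Fi). Qed.

Lemma avg_factor_unit : avg_factor \in unitmx.
Proof. exact/posdef_unit/isqrt_posdef/avg_posdef. Qed.

Lemma avg_factorP v w :
  qavg (F (v *m avg_factor)) (F (w *m avg_factor)) = mxdot v w.
Proof.
rewrite (gramE qavg_inner) //.
have [[Is _] IMI] := isqrtP avg_posdef.
by rewrite mxdot_mulr Is -!mulmxA (mulmxA (isqrt _)) IMI mulmx1.
Qed.

(** Multiplication by a unit quaternion is orthogonal and preserves the averaged Gram
    matrix, so it commutes with the inverse square root of that matrix. *)
Lemma avg_factor_comm r v : qvec r v *m avg_factor = qvec r (v *m avg_factor).
Proof.
have unit s w : qdot s s = 1 -> qvec s w *m avg_factor = qvec s (w *m avg_factor).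
  move=> s1; pose L := mxlin (qvec s).
  have LE u : u *m L = qvec s u by exact: mul_mxlin (qvec_linr s).
  have oL : L *m L^T = 1%:M.
    apply: mxdot_ext => u t; rewrite mulmxA mulmx1 mxdotC mxdot_mulr trmxK !LE.
    by rewrite mxdot_qvec s1 mul1r mxdotC.
  have LG : L *m gram qavg F *m L^T = gram qavg F.
    apply: mxdot_ext => u t.
    rewrite 2!mulmxA mxdotC mxdot_mulr trmxK mxdotC !LE.
    by rewrite -!(gramE qavg_inner) // !FA qavg_inv.
  have := isqrt_conj avg_posdef oL; rewrite LG -/avg_factor => Te.
  rewrite -!LE {2}Te !mulmxA.
  by rewrite -(mulmxA _ L^T L) (mulmx1C oL) mulmx1.
rewrite [in LHS](qbaseE r) [in RHS](qbaseE r) (lin_sum (qvec_linl _)).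
rewrite (lin_sum (qvec_linl _)) mulmx_suml; apply: eq_bigr => b _.
by rewrite !(linZ (qvec_linl _)) -scalemxAl unit // qdot_base eqxx.
Qed.

Definition avg_frame v := F (v *m avg_factor).

Lemma avg_frame_linear : linear avg_frame.
Proof. by move=> a u v; rewrite /avg_frame mulmxDl -scalemxAl Fl. Qed.

Lemma avg_frame_inj : injective avg_frame.
Proof.
move=> u v /Fi /(congr1 (mulmx^~ (invmx avg_factor))).
by rewrite !mulmxK // avg_factor_unit.
Qed.

Lemma avg_frame_act r v : avg_frame (qvec r v) = A r (avg_frame v).
Proof. by rewrite /avg_frame avg_factor_comm FA. Qed.

Definition polar_factor := isqrt (gram ip avg_frame).

Lemma polar_posdef : posdef (gram ip avg_frame).
Proof. exact (gram_posdef ipP avg_frame_linear avg_frame_inj). Qed.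

Lemma polar_factor_unit : polar_factor \in unitmx.
Proof. exact/posdef_unit/isqrt_posdef/polar_posdef. Qed.

Definition unitary_frame v := F (v *m (polar_factor *m avg_factor)).

Lemma unitary_frameE v : unitary_frame v = avg_frame (v *m polar_factor).
Proof. by rewrite /unitary_frame mulmxA. Qed.

Lemma unitary_frameP v w : ip (unitary_frame v) (unitary_frame w) = mxdot v w.
Proof.
rewrite !unitary_frameE (gramE ipP); last exact: avg_frame_linear.
have [[Is _] IMI] := isqrtP polar_posdef.
by rewrite mxdot_mulr Is -!mulmxA (mulmxA (isqrt _)) IMI mulmx1.
Qed.

End Normalise.
End Action.

(** An automorphism of H is orthogonal, so both actions have the same averaged inner
    product. The averaged frames therefore differ by an orthogonal matrix G, and G
    conjugates one polar factor into the other: the unitary frames differ by the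
    same G, which is kappa-semilinear because the averaged frames are H-linear. *)
Lemma unitary_transition (A1 A2 : quat R -> V -> V) (kappa : quat R -> quat R)
    (F1 F2 : 'rV[R]_N -> V) (k2 : V -> 'rV[R]_N) :
  is_left_module (qone R) (@qmul R) A1 -> is_left_module (qone R) (@qmul R) A2 ->
  is_alg_aut (qone R) (@qmul R) kappa -> (forall r u, A1 r u = A2 (kappa r) u) ->
  linear F1 -> injective F1 -> linear F2 -> cancel F2 k2 -> cancel k2 F2 ->
  (forall r v, F1 (qvec r v) = A1 r (F1 v)) ->
  (forall r v, F2 (qvec r v) = A2 r (F2 v)) ->
  exists G : 'M[R]_N, [/\ G *m G^T = 1%:M,
    forall v, unitary_frame A1 F1 v = unitary_frame A2 F2 (v *m G)
    & forall r v, qvec r v *m G = qvec (kappa r) (v *m G)].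
Proof.
move=> AP1 AP2 kP Ak Fl1 Fi1 Fl2 FK2 kF2 FA1 FA2.
have Fi2 := can_inj FK2; have [kl _ _ _] := kP.
pose T2 := avg_factor A2 F2; have T2u : T2 \in unitmx by exact: avg_factor_unit.
pose E1 := avg_frame A1 F1; pose E2 := avg_frame A2 F2.
have E1l : linear E1 by exact: avg_frame_linear.
have E2l : linear E2 by exact: avg_frame_linear.
have E2i : injective E2 by exact: avg_frame_inj.
pose g v := k2 (E1 v) *m invmx T2.
have gE v : E2 (g v) = E1 v by rewrite /E2 /avg_frame /g mulmxKV.
have gl : linear g by move=> a u v; apply: E2i; rewrite E2l !gE E1l.
pose G := mxlin g; have GE v : E2 (v *m G) = E1 v by rewrite mul_mxlin.
have avgE u v : qavg A1 u v = qavg A2 u v.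
  rewrite -(qavg_sub AP2 _ _ kl (alg_aut_isom kP)).
  by apply: eq_bigr => b _; rewrite !Ak.
have oG : G *m G^T = 1%:M.
  apply: mxdot_ext => u t; rewrite mulmxA mulmx1 mxdotC mxdot_mulr trmxK mxdotC.
  rewrite -(avg_factorP AP2 Fl2 Fi2) -!/(avg_frame _ _ _) -!/(E2 _) !GE -avgE.
  exact: avg_factorP.
exists G; split=> // [v|r v]; last first.
  apply: E2i; rewrite GE /E1 /E2 !avg_frame_act // -/E1 -/E2 GE.
  exact: Ak.
rewrite !unitary_frameE -/E1 -/E2 -GE; congr E2.
have gramG : gram ip E1 = G *m gram ip E2 *m G^T.
  apply: mxdot_ext => u t; rewrite -(gramE ipP) // -!GE (gramE ipP) //.
  by rewrite [in RHS]mulmxA [in RHS]mulmxA [RHS]mxdotC [RHS]mxdot_mulr trmxK mxdotC.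
rewrite /polar_factor gramG isqrt_conj //; last exact: polar_posdef.
by rewrite -!mulmxA (mulmx1C oG) mulmx1.
Qed.

End Average.

(** * Quaternionic bases *)

Definition qcomb (V : lmodType R) (A : quat R -> V -> V) (w : nat -> V) k
    (u : 'M[R]_(k, 4)) : V :=
  \sum_(l < k) A (quat_of_row (row l u)) (w l).

Lemma qcomb_linear V A w k : is_left_module (qone R) (@qmul R) A ->
  linear (@qcomb V A w k).
Proof.
move=> AP a u v; rewrite /qcomb scaler_sumr -big_split; apply: eq_bigr => l _ /=.
by rewrite qrow_linear (act_linl AP).
Qed.

Lemma qcomb_scale V A w k r u : is_left_module (qone R) (@qmul R) A ->
  @qcomb V A w k (qscale r u) = A r (qcomb A w u).
Proof.
move=> AP; rewrite /qcomb (lin_sum (act_linr AP r)); apply: eq_bigr => l _ /=.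
by have [_ _ AM] := AP; rewrite row_qscale AM.
Qed.

(** The combinations of k vectors fill a real subspace of dimension at most 4 k, so
    some v lies outside it as long as 4 k < m. A relation q v + ... = 0 forces q = 0,
    since q is invertible otherwise and v would be a combination. *)
Lemma qbasis_exists m k (A : quat R -> 'rV[R]_m -> 'rV[R]_m) :
  is_left_module (qone R) (@qmul R) A -> (k * 4 <= m)%N ->
  exists w : nat -> 'rV[R]_m, injective (@qcomb _ A w k).
Proof.
move=> AP; elim: k => [|k IH] km.
  by exists (fun=> 0) => u v _; apply/matrixP => -[].
have km' : (k * 4 < m)%N by apply: leq_trans km; rewrite ltn_pmul2r.
have [w wi] := IH (ltnW km').
pose f (v : 'rV[R]_(k * 4)) := qcomb A w (vec_mx v).
have fl : linear f by move=> a u v; rewrite /f linearD linearZ qcomb_linear.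
have /row_subPn[i vK] : ~~ (1%:M <= mxlin f)%MS.
  apply/negP => /mxrankS; rewrite mxrank1 leqNgt => /negP; apply.
  exact: leq_ltn_trans (rank_leq_row _) km'.
pose v := row i (1%:M : 'M[R]_m); pose w' l := if (l < k)%N then w l else v.
have fv (u : 'M[R]_(k, 4)) : qcomb A w u != v.
  apply: contra vK => /eqP e; rewrite -/v -e.
  have -> : qcomb A w u = mxvec u *m mxlin f by rewrite (mul_mxlin _ fl) /f mxvecK.
  exact: submxMl.
have wE u : qcomb A w' (u : 'M[R]_(k.+1, 4)) =
  qcomb A w (\matrix_l row (widen_ord (leqnSn k) l) u) +
  A (quat_of_row (row ord_max u)) v.
  rewrite /qcomb big_ord_recr /= /w' ltnn; congr (_ + _).
  by apply: eq_bigr => l _; rewrite ltn_ord rowK.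
exists w'.
have inj0 (u : 'M[R]_(k.+1, 4)) : qcomb A w' u = 0 -> u = 0.
  rewrite wE; set q := quat_of_row _; set z := \matrix_l _ => zq.
  have q0 : q = 0.
    apply/eqP/negPn/negP => q0; have [_ A1 AM] := AP.
    have := fv (qscale (-1 *: ((qdot q q)^-1 *: qconj q)) z).
    rewrite qcomb_scale //; move: zq => /eqP; rewrite addr_eq0 => /eqP ->.
    rewrite (linZ (act_linl AP _)) -[- A q v]scaleN1r (linZ (act_linr AP _)).
    by rewrite scalerA mulrNN mulr1 scale1r -AM qmulVr // A1 eqxx.
  move: zq; rewrite q0 (lin0 (act_linl AP _)) addr0 => zq.
  have z0 : z = 0 by apply: wi; rewrite zq (lin0 (qcomb_linear w AP)).
  apply/row_matrixP => l; rewrite row0.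
  have [lk|lk] := ltnP l k.
    have := congr1 (row (Ordinal lk)) z0; rewrite rowK row0 => <-.
    by congr row; apply: val_inj.
  have -> : l = ord_max.
    by apply/val_inj/eqP; rewrite eqn_leq lk -ltnS ltn_ord.
  by rewrite -[row _ _]quat_of_rowK -/q q0 (lin0 (@row_of_quat_linear R)).
move=> u t ut; apply/eqP; rewrite -subr_eq0; apply/eqP/inj0.
by rewrite (linB (qcomb_linear w' AP)) ut subrr.
Qed.

End Pointwise.

(** * Unitary charts from an H_lambda-structure *)

Section Forward.
Variables (R : realType) (X : topologicalType).
Variables (delta : orth_bundle R X 1) (lam : C_line delta).

Section Limits.
Context {T : Type} {F : set_system T} {FF : Filter F}.

Lemma cvg_scale m (E : orth_bundle R X m) (b : T -> X) (c : T -> R)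
    (v : forall t, E (b t)) x (w : E x) (d : R) :
  c @ F --> d ->
  inTot (v t) @[t --> F] --> (inTot w : tot E) ->
  inTot (c t *: v t) @[t --> F] --> (inTot (d *: w) : tot E).
Proof.
move=> cd vw; have e y (u : E y) a : a *: u = (a - 1) *: u + u.
  by rewrite -[X in _ + X]scale1r -scalerDl subrK.
rewrite e; under eq_cvg do rewrite e.
by apply: cvg_lin => //; apply: cvgB => //; exact: cvg_cst.
Qed.

Lemma cvg_lam_mul (b : T -> X) (a : forall t, delta (b t)) (v : forall t, lam (b t))
    x (a0 : delta x) (v0 : lam x) :
  inTot (a t) @[t --> F] --> (inTot a0 : tot delta) ->
  inTot (v t) @[t --> F] --> (inTot v0 : tot lam) ->
  inTot (lam_mul (a t) (v t)) @[t --> F] --> (inTot (lam_mul a0 v0) : tot lam).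
Proof.
move=> ca cv; pose S := sum_fam (sum_fam (triv_fam R X) delta) lam.
have : inTot (((0, a t), v t) : S (b t)) @[t --> F] -->
    (inTot (((0, a0), v0) : S x) : tot S).
  apply: (cvg_sumI _ cv); apply: (cvg_sumI _ ca).
  by apply/cvg_trivP; split; [exact: cvg_base ca | exact: cvg_cst].
move=> cS; exact: cvg_comp cS
  (@cl_continuous _ _ _ lam (inTot (((0, a0), v0) : S x))).
Qed.

Lemma cvg_frame (b : T -> X) (a : forall t, delta (b t)) (f : forall t, lam (b t))
    (r : T -> quat R) x (a0 : delta x) (f0 : lam x) (r0 : quat R) :
  inTot (a t) @[t --> F] --> (inTot a0 : tot delta) ->
  inTot (f t) @[t --> F] --> (inTot f0 : tot lam) ->
  (r t).1 @[t --> F] --> r0.1 -> (r t).2 @[t --> F] --> r0.2 ->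
  inTot (frame (a t) (f t) (r t)) @[t --> F] -->
    (inTot (frame a0 f0 r0) : tot (H_fam lam)).
Proof.
move=> ca cf r1 /cvg_mxP r2; have bx := cvg_base ca.
apply: cvg_sumI; first by apply/cvg_trivP.
apply: cvg_sumI; first exact: cvg_scale.
by apply: cvg_lin => //; apply: cvg_scale => //; exact: cvg_lam_mul.
Qed.

End Limits.

Section Action.
Variables (n : nat) (xi : orth_bundle R X (n * 4)).
Variable act : forall x, H_fam lam x -> xi x -> xi x.
Hypothesis act_module :
  forall x, is_left_module (1, 0) (@H_mul _ _ _ lam x) (@act x).
Hypothesis act_continuous :
  fam_map_continuous (E := sum_fam (H_fam lam) xi) (fun x e => act e.1 e.2).

Definition frame_act x (a : delta x) (f : lam x) (r : quat R) (u : xi x) : xi x :=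
  act (frame a f r) u.

Lemma frame_act_module x (a : delta x) (f : lam x) : ip a a = 1 -> ip f f = 1 ->
  is_left_module (qone R) (@qmul R) (frame_act a f).
Proof.
move=> aa ff; have [[al ar] a1 aM] := act_module x; split=> [|u|r s u].
- split=> [r|u c r s]; first exact: al.
  by rewrite /frame_act frame_linear (ar u).
- by rewrite /frame_act frame1 a1.
- by rewrite /frame_act frameM // aM.
Qed.

Lemma cvg_act T (F : set_system T) (FF : Filter F) (b : T -> X)
    (p : forall t, H_fam lam (b t)) (u : forall t, xi (b t)) x (p0 : H_fam lam x)
    (u0 : xi x) :
  inTot (p t) @[t --> F] --> (inTot p0 : tot (H_fam lam)) ->
  inTot (u t) @[t --> F] --> (inTot u0 : tot xi) ->
  inTot (act (p t) (u t)) @[t --> F] --> (inTot (act p0 u0) : tot xi).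
Proof.
move=> cp cu; pose S := sum_fam (H_fam lam) xi.
have cS : inTot ((p t, u t) : S (b t)) @[t --> F] -->
    (inTot ((p0, u0) : S x) : tot S) by exact: cvg_sumI.
exact: cvg_comp cS (@act_continuous (inTot ((p0, u0) : S x))).
Qed.

(** A quaternionic basis of the fibre at x0, extended by sections that are constant in a
    chart, remains a basis on the open set where the matrix K of its real
    coordinates is invertible. The averaging and polar factors of this frame vary
    continuously, so its unitary frame is again a chart. *)
Lemma unitary_chart (W : set X) (a : forall x, delta x) (x0 : X) :
  open W -> W x0 -> (forall x, W x -> ip (a x) (a x) = 1) ->
  (forall x, W x -> inTot (a y) @[y --> x] --> (inTot (a x) : tot delta)) ->
  exists (V : set X) (f : forall x, lam x) (F : forall x, 'rV[R]_(n * 4) -> xi x)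
    (k : forall x, xi x -> 'rV[R]_(n * 4)),
  [/\ V x0, V `<=` W, forall x, V x -> ip (f x) (f x) = 1,
      forall x, V x -> [/\ linear (F x), cancel (F x) (k x), cancel (k x) (F x) &
        forall r v, F x (qvec r v) = frame_act (a x) (f x) r (F x v)]
    & is_chart V (fun x (v : 'M[R]_(n, 4)) =>
        unitary_frame (@ip _ _ _ xi x) (frame_act (a x) (f x)) (F x) (mxvec v))].
Proof.
move=> oW Wx0 aa ac.
have [U1 [h1 [k1 [U1x0 h1P h1I]]]] := isometric_chart lam x0.
have [U2 [h2 [k2 [U2x0 h2P]]]] := ob_chart xi x0.
have [oU1 _ _ _ _] := h1P; have [oU2 h2l h2K _ _] := h2P.
pose f x := h1 x (delta_mx 0 0).
have ff x : U1 x -> ip (f x) (f x) = 1.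
  move=> U1x; rewrite h1I // mxdotE big_ord1 big_ord_recl big_ord1 !mxE /=.
  by rewrite mulr1 mulr0 addr0.
have fc x : U1 x -> inTot (f y) @[y --> x] --> (inTot (f x) : tot lam).
  by move=> U1x; apply: (cvg_chart h1P U1x); [exact: cvg_id | exact: cvg_cst].
pose A x := frame_act (a x) (f x).
have AP x : W x -> U1 x -> is_left_module (qone R) (@qmul R) (A x).
  by move=> Wx U1x; apply: frame_act_module; [exact: aa | exact: ff].
have k2l x : U2 x -> linear (k2 x).
  move=> U2x c u v; have [hK kK] := h2K _ U2x.
  by apply: (can_inj hK); rewrite h2l // !kK.
pose alpha r v := k2 x0 (A x0 r (h2 x0 v)).
have alphaP : is_left_module (qone R) (@qmul R) alpha.
  have [hK kK] := h2K _ U2x0; have [[Al Ar] A1 AM] := AP _ Wx0 U1x0.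
  split=> [|v|r s v]; rewrite /alpha ?A1 ?hK //; last by rewrite AM kK.
  by split=> [r c u v|v c r s]; rewrite -k2l // ?h2l ?Al ?Ar.
have [w wi] := qbasis_exists alphaP (leqnn (n * 4)).
pose comb x (v : 'rV[R]_(n * 4)) := qcomb (A x) (fun l => h2 x (w l)) (vec_mx v).
pose K x := mxlin (fun v => k2 x (comb x v)).
have combl x : W x -> U1 x -> linear (comb x).
  by move=> Wx U1x c u v;
    rewrite /comb linearD linearZ (qcomb_linear _ (AP _ Wx U1x)).
have KE x v : W x -> U1 x -> U2 x -> h2 x (v *m K x) = comb x v.
  move=> Wx U1x U2x; rewrite mul_mxlin; last first.
    by move=> c u v'; rewrite combl // k2l.
  by have [_ ->] := h2K _ U2x.
have Kx0 : K x0 \in unitmx.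
  rewrite -row_free_unit; apply: inj_row_free => v /(congr1 (h2 x0)).
  rewrite KE // (lin0 (h2l _ U2x0)) => v0.
  have [hK kK] := h2K _ U2x0.
  have e : qcomb alpha w (vec_mx v) = qcomb alpha w (0 : 'M[R]_(n, 4)).
    rewrite (lin0 (qcomb_linear _ alphaP)) /qcomb /alpha.
    by rewrite -(lin_sum (k2l _ U2x0)) -[X in k2 x0 X]/(comb x0 v) v0
      (lin0 (k2l _ U2x0)).
  by have := congr1 mxvec (wi _ _ e); rewrite vec_mxK linear0.
have Ac x r (u : forall y, xi y) : W x -> U1 x ->
    inTot (u y) @[y --> x] --> (inTot (u x) : tot xi) ->
    inTot (A y r (u y)) @[y --> x] --> (inTot (A x r (u x)) : tot xi).
  move=> Wx U1x uc; apply: cvg_act => //; apply: cvg_frame;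
    [exact: ac | exact: fc | exact: cvg_cst | exact: cvg_cst].
have Kc x : W x -> U1 x -> U2 x -> K y @[y --> x] --> K x.
  move=> Wx U1x U2x; apply/cvg_mxP => i j.
  have e y : U2 y -> K y i j = \sum_(l < n)
      k2 y (A y (quat_of_row (row l (vec_mx (delta_mx 0 i)))) (h2 y (w l))) 0 j.
    by move=> U2y; rewrite !mxE /comb /qcomb (lin_sum (k2l _ U2y)) summxE.
  rewrite e //; apply: (@cvg_trans _ (\sum_(l < n)
      k2 y (A y (quat_of_row (row l (vec_mx (delta_mx 0 i)))) (h2 y (w l))) 0 j
        @[y --> x])).
    by apply: near_eq_cvg; apply: filterS (near_base oU2 U2x cvg_id) => y U2y;
      rewrite e.
  apply: cvg_sumR => l; apply: (iffLR (cvg_mxP _ _)).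
  apply: (cvg_coord h2P U2x); apply: Ac => //.
  by apply: (cvg_chart h2P U2x); [exact: cvg_id | exact: cvg_cst].
pose V := [set x | [/\ W x, U1 x, U2 x & K x \in unitmx]].
have oV : open V.
  rewrite openE => x [Wx U1x U2x Ku]; rewrite /interior.
  apply: filterS3 (near_base oU1 U1x cvg_id) (near_base oU2 U2x cvg_id) _.
    by move=> y U1y U2y; exact:
      (fun h : W y /\ K y \in unitmx => And4 h.1 U1y U2y h.2).
  apply: filterS2 (near_base oW Wx cvg_id) (near_unitmx (Kc _ Wx U1x U2x) Ku).
  by [].
pose F x v := h2 x (v *m K x).
have FE x v : V x -> F x v = comb x v by case=> Wx U1x U2x _; exact: KE.
pose k x u := k2 x u *m invmx (K x).
have FP x : V x -> [/\ linear (F x), cancel (F x) (k x), cancel (k x) (F x) &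
    forall r v, F x (qvec r v) = frame_act (a x) (f x) r (F x v)].
  move=> Vx; have [Wx U1x U2x Ku] := Vx; have [hK kK] := h2K _ U2x; split.
  - by move=> c u v; rewrite !FE // combl.
  - by move=> v; rewrite /k /F hK mulmxK.
  - by move=> u; rewrite /k /F mulmxKV // kK.
  - move=> r v; rewrite !FE // /comb /qvec mxvecK.
    exact: qcomb_scale (AP _ Wx U1x).
have FI x : V x -> injective (F x) by move=> /FP[_ FK _ _]; exact: can_inj FK.
pose T x := avg_factor (@ip _ _ _ xi x) (A x) (F x).
pose M x := polar_factor (@ip _ _ _ xi x) (A x) (F x).
have Fc x i : V x -> inTot (F y (delta_mx 0 i)) @[y --> x] -->
    (inTot (F x (delta_mx 0 i)) : tot xi).
  case=> Wx U1x U2x Ku; apply: (cvg_chart h2P U2x); first exact: cvg_id.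
  by apply: cvg_mulmx; [exact: cvg_cst | exact: Kc].
have Tc x : V x -> T y @[y --> x] --> T x.
  move=> Vx; have [Wx U1x U2x Ku] := Vx.
  have pd y : V y -> posdef (gram (qavg (@ip _ _ _ xi y) (A y)) (F y)).
    move=> Vy; have [Wy U1y U2y _] := Vy; have [Fl _ _ _] := FP _ Vy.
    exact (avg_posdef (ip_inner xi y) (AP _ Wy U1y) Fl (FI _ Vy)).
  apply: cvg_isqrt; [| exact: pd | exact: filterS (near_base oV Vx cvg_id)].
  apply/cvg_mxP => i j; rewrite mxE; under eq_cvg do rewrite mxE.
  by apply: cvg_sumR => b; apply: cvg_ip; apply: Ac => //; exact: Fc.
have Mc x : V x -> M y @[y --> x] --> M x.
  move=> Vx; have [Wx U1x U2x Ku] := Vx.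
  have pd y : V y -> posdef
    (gram (@ip _ _ _ xi y) (avg_frame (@ip _ _ _ xi y) (A y) (F y))).
    move=> Vy; have [Wy U1y U2y _] := Vy; have [Fl _ _ _] := FP _ Vy.
    exact (polar_posdef (ip_inner xi y) (AP _ Wy U1y) Fl (FI _ Vy)).
  apply: cvg_isqrt; [| exact: pd | exact: filterS (near_base oV Vx cvg_id)].
  apply/cvg_mxP => i j; rewrite mxE; under eq_cvg do rewrite mxE.
  have sc l : inTot (avg_frame (@ip _ _ _ xi y) (A y) (F y) (delta_mx 0 l))
    @[y --> x] -->
     (inTot (avg_frame (@ip _ _ _ xi x) (A x) (F x) (delta_mx 0 l)) : tot xi).
    apply: (cvg_chart h2P U2x); first exact: cvg_id.
    apply: cvg_mulmx; last exact: Kc.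
    by apply: cvg_mulmx; [exact: cvg_cst | exact: Tc].
  by apply: cvg_ip; exact: sc.
exists V, f, F, k; split.
- by split.
- by move=> x [].
- by move=> x [_ U1x _ _]; exact: ff.
- exact: FP.
apply/is_chartP.
have chP : chart_with V (fun x v => h2 x (v *m (M x *m T x *m K x)))
    (fun x e => k2 x e *m invmx (M x *m T x *m K x)).
  apply: (chart_mul h2P oV) => [x []//|x Vx].
  have [Wx U1x U2x Ku] := Vx; have [Fl _ _ _] := FP _ Vx; split.
    rewrite !unitmx_mul Ku andbT; apply/andP; split.
      exact (polar_factor_unit (ip_inner xi x) (AP _ Wx U1x) Fl (FI _ Vx)).
    exact (avg_factor_unit (ip_inner xi x) (AP _ Wx U1x) Fl (FI _ Vx)).
  apply: cvg_mulmx; last exact: Kc.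
  by apply: cvg_mulmx; [exact: Mc | exact: Tc].
have := chart_mxvec chP;
  rewrite (_ : (fun x v => h2 x _) = (fun x (v : 'M[R]_(n, 4)) =>
    unitary_frame (@ip _ _ _ xi x) (frame_act (a x) (f x)) (F x) (mxvec v))).
  by move=> chP'; exists (fun x e => vec_mx (k2 x e *m invmx (M x *m T x *m K x))).
apply: functional_extensionality_dep => x; apply: funext => v.
by rewrite /unitary_frame /F !mulmxA.
Qed.

End Action.
End Forward.

(** * Isometries semilinear over an automorphism *)

Section TwistedUnitary.
Variables (R : realType) (n : nat).

Definition qi : quat R := (0, delta_mx 0 0).

Lemma quat_of_CE (z : R[i]) :
  quat_of_C z = complex.Re z *: qone R + complex.Im z *: qi.
Proof.
congr pair; rewrite /= ?scaler0 ?add0r //.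
by rewrite addr0; exact/esym/mulr1.
Qed.

(** For c = 1 such an isometry is complex linear, for c = -1 complex antilinear. *)
Definition twisted (g : 'M[R]_(n, 4) -> 'M[R]_(n, 4)) (c : R) : Prop :=
  OV g /\ exists kappa, [/\ is_alg_aut (qone R) (@qmul R) kappa,
    forall v r, g (qscale r v) = qscale (kappa r) (g v) & kappa qi = c *: qi].

Lemma twisted_TSp g c : twisted g c -> TSp g.
Proof. by case=> Og [kappa [kP kg _]]; split=> //; exists kappa. Qed.

Lemma twisted_C kappa c z : is_alg_aut (qone R) (@qmul R) kappa ->
  kappa qi = c *: qi ->
  kappa (quat_of_C z) = complex.Re z *: qone R + (c * complex.Im z) *: qi.
Proof.
case=> kl _ k1 _ ki; rewrite quat_of_CE (linD kl) !(linZ kl) k1 ki.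
by rewrite scalerA mulrC.
Qed.

Lemma twisted_UV g : twisted g 1 -> UV g.
Proof.
case=> Og [kappa [kP kg ki]]; split=> // z v.
by rewrite /cscale kg (twisted_C _ kP ki) mul1r -quat_of_CE.
Qed.

Lemma twisted_TU g c : c ^+ 2 = 1 -> twisted g c -> TU g.
Proof.
move=> c2 [Og [kappa [kP kg ki]]]; split=> //.
move/eqP: c2; rewrite sqrf_eq1 => /orP[]/eqP c1; rewrite {}c1 in ki.
  exists idfun; split=> [|//|v z]; first by exists id.
  by rewrite /cscale kg (twisted_C _ kP ki) mul1r -quat_of_CE.
exists (conjc (R := R)); split=> [|t|v z].
- by exists conjc; exact: conjcK.
- by rewrite /= oppr0.
rewrite /cscale kg (twisted_C _ kP ki) quat_of_CE.
by case: z => a b /=; rewrite mulN1r.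
Qed.

End TwistedUnitary.

(** * Reduction of the structure group *)

Section ForwardAtlas.
Variables (R : realType) (X : topologicalType).
Variables (delta : orth_bundle R X 1) (lam : C_line delta).
Variables (n : nat) (xi : orth_bundle R X (n * 4)).

Record unit_section (W : set X) (a : forall x, delta x) : Prop := UnitSection {
  us_open : open W;
  us_unit : forall x, W x -> ip (a x) (a x) = 1;
  us_cont : forall x, W x -> inTot (a y) @[y --> x] --> (inTot (a x) : tot delta)
}.

Lemma unit_section_exists x0 : exists W a, W x0 /\ unit_section W a.
Proof.
have [U [h [k [Ux0 hP hI]]]] := isometric_chart delta x0.
exists U, (fun x => h x (const_mx 1)); split=> //; split.
- by case: hP.
- by move=> x Ux; rewrite hI // mxdotE !big_ord1 !mxE mulr1.
- by move=> x Ux; apply: (cvg_chart hP Ux); [exact: cvg_id | exact: cvg_cst].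
Qed.

Lemma frame_aut x (a b : delta x) (f e : lam x) :
  ip a a = 1 -> ip b b = 1 -> ip f f = 1 -> ip e e = 1 ->
  let kappa r := frame_inv b e (frame a f r) in
  is_alg_aut (qone R) (@qmul R) kappa /\ kappa (qi R) = ip a b *: qi R.
Proof.
move=> aa bb ff ee kappa.
have fK := frame_invK bb ee; have Kf := frameK bb ee.
split; last first.
  rewrite /kappa /frame_inv /frame_im_inv /=; congr pair;
    first by rewrite /= scaler0.
  by apply: rV3P; rewrite !mxE /= ?scale0r ?scale1r ?addr0 ?mulr1 ?mulr0
    ?(inner0l (ip_inner _ _)).
split.
- by move=> c r s; apply: (can_inj Kf); rewrite fK !frame_linear /kappa !fK.
- exists (fun r => frame_inv a f (frame b e r)) => r; rewrite /kappa.
    by rewrite fK frameK.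
  by rewrite frame_invK // Kf.
- by rewrite /kappa frame1 -(frame1 b e) Kf.
- by move=> r s; apply: (can_inj Kf); rewrite fK !frameM // !fK.
Qed.

(** The transition function between the unitary charts of two local frames of H_lambda
    is semilinear over the automorphism that compares these frames, and that
    automorphism maps i to plus or minus i according to the unit sections of delta. *)
Lemma H_structure_atlas (J : Type) (W : J -> set X) (a : J -> forall x, delta x) :
  (forall x, exists j, W j x) -> (forall j, unit_section (W j) (a j)) ->
  has_H_structure lam xi ->
  exists (I : Type) (idx : I -> J) (U : I -> set X)
    (h : forall (i : I) (x : X), 'M[R]_(n, 4) -> xi x),
  [/\ forall x, exists i, U i x,
      forall i, is_chart (U i) (h i) /\ U i `<=` W (idx i),
      forall i x, U i x -> forall v w, ip (h i x v) (h i x w) = mxdot v w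
    & forall i j x, U i x -> U j x ->
        exists2 g, twisted g (ip (a (idx j) x) (a (idx i) x)) &
          forall v, h j x v = h i x (g v)].
Proof.
move=> cov us [act [actm actc]].
(* The atlas consists of all local data with the required properties, so that none
   has to be selected at each point. *)
pose data := (J * set X * (forall x, lam x) * (forall x, 'rV[R]_(n * 4) -> xi x) *
  (forall x, xi x -> 'rV[R]_(n * 4)))%type.
pose dj (d : data) := d.1.1.1.1; pose dV (d : data) := d.1.1.1.2.
pose df (d : data) := d.1.1.2; pose dF (d : data) := d.1.2.
pose dk (d : data) := d.2.
pose dh (d : data) x (v : 'M[R]_(n, 4)) :=
  unitary_frame (@ip _ _ _ xi x) (frame_act act (a (dj d) x) (df d x)) (dF d x)
    (mxvec v).
pose good (d : data) :=
  [/\ dV d `<=` W (dj d), forall x, dV d x -> ip (df d x) (df d x) = 1,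
      forall x, dV d x -> [/\ linear (dF d x), cancel (dF d x) (dk d x),
        cancel (dk d x) (dF d x) &
        forall r v, dF d x (qvec r v) = frame_act act (a (dj d) x) (df d x) r
          (dF d x v)]
    & is_chart (dV d) (dh d)].
exists {d : data | good d}, (fun i => dj (sval i)), (fun i => dV (sval i)),
  (fun i => dh (sval i)); split.
- move=> x; have [j Wx] := cov x; have [oW aa ac] := us j.
  have [V [f [F [k [Vx VW ff FP hP]]]]] := unitary_chart actm actc oW Wx aa ac.
  by exists (exist good (j, V, f, F, k) (And4 VW ff FP hP)).
- by case=> d [VW ff FP hP].
- case=> d [VW ff FP hP] /= x Vx v w; have [Fl FK _ FA] := FP x Vx.
  have [_ aa _] := us (dj d).
  rewrite /dh unitary_frameP ?mxdot_mxvec //; first exact: ip_inner.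
    by apply: frame_act_module; [exact: actm|apply/aa/VW|exact: ff].
  exact: can_inj FK.
move=> [d1 [VW1 ff1 FP1 hP1]] [d2 [VW2 ff2 FP2 hP2]] x /= V1x V2x.
have [_ /(_ _ (VW1 _ V1x)) aa1 _] := us (dj d1).
have [_ /(_ _ (VW2 _ V2x)) aa2 _] := us (dj d2).
have f1 := ff1 _ V1x; have f2 := ff2 _ V2x.
have [Fl1 FK1 kF1 FA1] := FP1 _ V1x; have [Fl2 FK2 kF2 FA2] := FP2 _ V2x.
have [kP ki] := frame_aut aa2 aa1 f2 f1; set kappa := fun r => _ in kP ki.
have Ak r u : frame_act act (a (dj d2) x) (df d2 x) r u =
    frame_act act (a (dj d1) x) (df d1 x) (kappa r) u.
  by rewrite /frame_act /kappa frame_invK.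
have AP1 := frame_act_module actm aa1 f1.
have AP2 := frame_act_module actm aa2 f2.
have [G [oG hG qG]] := unitary_transition (ip_inner xi x) AP2 AP1 kP Ak Fl2
  (can_inj FK2) Fl1 FK1 kF1 FA2 FA1.
exists (fun v => vec_mx (mxvec v *m G)); last first.
  by move=> v; rewrite /dh hG vec_mxK.
split.
  split; first by move=> c u v;
    rewrite linearD linearZ mulmxDl -scalemxAl linearD linearZ.
  move=> u v; rewrite -[LHS]mxdot_mxvec !vec_mxK mxdot_mulr -mulmxA oG mulmx1.
  exact: mxdot_mxvec.
exists kappa; split=> // v r.
have := qG r (mxvec v); rewrite /qvec !mxvecK => ->.
by rewrite mxvecK.
Qed.

End ForwardAtlas.

Section ForwardTheorems.
Variables (R : realType) (X : topologicalType).
Variables (n : nat) (xi : orth_bundle R X (n * 4)).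

Lemma line_unit (delta : orth_bundle R X 1) x (a b : delta x) :
  ip a a = 1 -> ip b b = 1 -> (ip a b) ^+ 2 = 1.
Proof.
move=> aa bb; have dP := ip_inner delta x.
by rewrite -[RHS]aa {2 3}(delta_span bb a) (innerZl dP) (innerZr dP) bb mulr1.
Qed.

Lemma H_structure_reduces_TU (delta : orth_bundle R X 1) (lam : C_line delta) :
  has_H_structure lam xi -> reduces_to xi (@TSp R n `&` @TU R n).
Proof.
move=> Hxi.
pose good (p : set X * (forall x, delta x)) := unit_section p.1 p.2.
have [||I [idx [U [h [cov hP hI tr]]]]] := @H_structure_atlas R X delta lam n xi
  {p | good p} (fun j => (sval j).1) (fun j => (sval j).2) _ _ Hxi.
- move=> x; have [W [a [Wx us]]] := unit_section_exists delta x.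
  by exists (exist good (W, a) us).
- by case.
exists I, U, h; split=> //; first by move=> i; have [] := hP i.
move=> i j x Ux Ux'; have [g gt gh] := tr i j x Ux Ux'; exists g => //.
have us k : U k x -> ip ((sval (idx k)).2 x) ((sval (idx k)).2 x) = 1.
  by move=> Ukx; have [_ WU] := hP k; have [_ aa _] := svalP (idx k); apply/aa/WU.
split; first exact: twisted_TSp gt.
by apply: twisted_TU gt; apply: line_unit; exact: us.
Qed.

Lemma triv_unit_section : unit_section (delta := triv_line R X) setT (fun=> 1 : R).
Proof.
split=> [|x _|x _]; [exact: openT | exact: mulr1 |].
by apply/cvg_trivP; split; [exact: cvg_id | exact: cvg_cst].
Qed.

Lemma H_structure_reduces_U (lam : complex_line R X) :
  has_H_structure lam xi -> reduces_to xi (@TSp R n `&` @UV R n).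
Proof.
move=> Hxi.
have [||I [idx [U [h [cov hP hI tr]]]]] :=
  @H_structure_atlas R X (triv_line R X) lam n xi
  unit (fun=> setT) (fun _ _ => 1 : R) _ _ Hxi.
- by move=> x; exists tt.
- by move=> _; exact: triv_unit_section.
exists I, U, h; split=> //; first by move=> i; have [] := hP i.
move=> i j x Ux Ux'; have [g gt gh] := tr i j x Ux Ux'; exists g => //.
have {}gt : twisted g 1 by move: gt; rewrite /ip /= /triv_ip mulr1.
split; [exact: twisted_TSp gt | exact: twisted_UV].
Qed.

End ForwardTheorems.

(** * Gluing bundles *)

Section GlueTopology.
Variables (R : realType) (X : topologicalType) (m : nat) (I : Type).
Variables (U : I -> set X) (h : I -> X -> 'rV[R]_m -> 'rV[R]_m).

Definition glue_fib (_ : X) : lmodType R := 'rV[R]_m.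

Definition glue_total (_ : I -> set X) (_ : I -> X -> 'rV[R]_m -> 'rV[R]_m) :
    Type :=
  {x : X & glue_fib x}.

Local Notation T := (glue_total U h).

Definition glue_inc (i : I) (z : X * 'rV[R]_m) : T :=
    existT glue_fib z.1 (h i z.1 z.2).

(** The final topology for the inclusions of the U_i x R^m. *)
Definition glue_open : set (set T) :=
    [set Q | forall i z, U i z.1 -> Q (glue_inc i z) ->
  \forall z' \near z, Q (glue_inc i z')].

Lemma glue_openT : glue_open setT.
Proof. by move=> i z _ _; exact: filterT. Qed.

Lemma glue_openI : setI_closed glue_open.
Proof.
move=> A B oA oB i z Uz [Az Bz]; exact: filterI (oA i z Uz Az) (oB i z Uz Bz).
Qed.

Lemma glue_open_bigU (K : Type) (f : K -> set T) :
  (forall k, glue_open (f k)) -> glue_open (\bigcup_k f k).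
Proof.
move=> of_ i z Uz [k _ fz]; apply: filterS (of_ k i z Uz fz) => z' fz'.
by exists k.
Qed.

HB.instance Definition _ := Choice.on T.
HB.instance Definition _ :=
  isOpenTopological.Build T glue_openT glue_openI glue_open_bigU.

Lemma glue_proj : continuous (fun e : T => projT1 e).
Proof.
apply/continuousP => A oA; suff : glue_open ((fun e : T => projT1 e) @^-1` A) by [].
move=> i z Uz Az; exact: (near_base oA Az (@fst_continuous _ _ z)).
Qed.

End GlueTopology.

Section Glue.
Variables (R : realType) (X : topologicalType) (m : nat) (I : Type).
Variables (U : I -> set X) (t : I -> I -> X -> 'M[R]_m).
Hypotheses (oU : forall i, open (U i)) (cov : forall x, exists i, U i x).
Hypothesis t1 : forall i x, U i x -> t i i x = 1%:M.
Hypothesis tM : forall i j k x, U i x -> U j x -> U k x ->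
  t i j x *m t j k x = t i k x.
Hypothesis tc : forall i j x, U i x -> U j x -> {for x, continuous (t i j)}.
Hypothesis tO : forall i j x, U i x -> U j x -> t i j x *m (t i j x)^T = 1%:M.

(** The fibre at x is R^m, read in one of the charts around x, say that of c x; the
    cocycle condition makes the other charts consistent with this choice. *)
Lemma glue_bundle : exists (E : orth_bundle R X m)
    (h : forall (i : I) (x : X), 'rV[R]_m -> E x)
      (k : forall (i : I) (x : X), E x -> 'rV[R]_m),
  [/\ forall i, chart_with (U i) (h i) (k i),
      forall i x, U i x -> forall v w, ip (h i x v) (h i x w) = mxdot v w
    & forall i j x, U i x -> U j x -> forall v, h i x v = h j x (v *m t i j x)].
Proof.
have [c Uc] := choice cov.
pose h i x (v : 'rV[R]_m) : 'rV[R]_m := v *m t i (c x) x.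
pose k i x (v : 'rV[R]_m) : 'rV[R]_m := v *m t (c x) i x.
have kh i j x v : U i x -> U j x -> k i x (h j x v) = v *m t j i x.
  by move=> Ui Uj; rewrite /k /h -mulmxA tM.
pose E := @VFam R X (@glue_fib R X m) (Topological.class (glue_total U h))
  (@glue_proj R X m I U h).
have hP i : @chart_with R X E 1 m (U i) (h i) (k i).
  split.
  - exact: oU.
  - by move=> x Ux a u v; rewrite /h mulmxDl -scalemxAl.
  - move=> x Ux; split=> v; rewrite /h /k -mulmxA tM ?t1 ?mulmx1 //; exact: Uc.
  - move=> z Uz A; rewrite nbhsE => -[Q [oO Oz] OA].
    have : @glue_open R X m I U h Q by exact: oO.
    by move=> /(_ i z Uz Oz); apply: filterS => z' /OA.
  - move=> e Ue A; rewrite nbhsE => -[B [oB Be] BA].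
    pose Q : set (glue_total U h) :=
      [set e' | U i (projT1 e') /\ B (k i (projT1 e') (projT2 e'))].
    have oO : @glue_open R X m I U h Q.
      move=> j z Uj [/= Ui Bz]; rewrite /= in Ui Bz.
      have cfst := @fst_continuous X 'rV[R]_m z.
      apply: filterS2 (near_base (oU i) Ui cfst) _; first by move=> z'; exact: conj.
      have : z'.2 *m t j i z'.1 @[z' --> z] --> z.2 *m t j i z.1.
        apply: cvg_mulmx; first exact: snd_continuous.
        exact: (@cvg_comp _ _ _ fst (t j i) _ _ _ cfst (tc Uj Ui)).
      move=> /(_ B); rewrite -(kh i j) // => /(_ (open_nbhs_nbhs (conj oB Bz))).
      apply: filterS2 (filterI (near_base (oU i) Ui cfst)
        (near_base (oU j) Uj cfst)).
      by move=> z' [U1 U2]; rewrite /= kh.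
    have : nbhs (e : glue_total U h) Q by apply: open_nbhs_nbhs; split.
    by apply: filterS => e' [_ /BA].
pose ipE (x : X) (u v : E x) : R := mxdot (u : 'rV[R]_m) (v : 'rV[R]_m).
have ipP x : is_inner (@ipE x).
  split=> [|u v|u u0]; rewrite /ipE.
  - split=> u a v w; first by rewrite mxdotDr mxdotZr.
    by rewrite mxdotDl mxdotZl.
  - exact: mxdotC.
  - by rewrite mxdot_gt0.
have ipk i x (u v : E x) : U i x -> mxdot (k i x u) (k i x v) = ipE x u v.
  move=> Ux; rewrite /k mxdot_mulr -mulmxA tO ?mulmx1 //; exact: Uc.
have ipc : continuous
  (fun e : tot (sum_fam E E) => ipE _ (projT2 e).1 (projT2 e).2).
  case=> x [u v]; pose i := c x; have Ux := Uc x.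
  pose e0 : tot (sum_fam E E) := existT _ x (u, v).
  have e1 : inTot (projT2 e).1 @[e --> e0] --> (inTot u : tot E) :=
    @sum_top_fst R X E E e0.
  have e2 : inTot (projT2 e).2 @[e --> e0] --> (inTot v : tot E) :=
    @sum_top_snd R X E E e0.
  have bx : projT1 e @[e --> e0] --> x := @tot_proj R X (sum_fam E E) e0.
  suff : ipE (projT1 e) (projT2 e).1 (projT2 e).2 @[e --> e0] --> ipE x u v by [].
  apply: (@cvg_trans _ (mxdot (k i (projT1 e) (projT2 e).1)
      (k i (projT1 e) (projT2 e).2) @[e --> e0])).
    apply: (@near_eq_cvg _ _ (nbhs e0)).
    apply: filterS (near_base (oU i) Ux bx) => e Ue.
    exact: ipk.
  rewrite -(ipk i) //.
  have c1 := cvg_coord (hP i) Ux e1; have c2 := cvg_coord (hP i) Ux e2.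
  exact: cvg_mxdot c1 c2.
have lt x : exists (V : set X) (g : forall y, 'M[R]_(1, m) -> E y), V x /\
  is_chart V g.
  exists (U (c x)), (h (c x)); split; first exact: Uc.
  by apply/is_chartP; exists (k (c x)); exact: hP.
exists (OrthBundle ipP ipc lt), h, k; split=> //.
- move=> i x Ux v w; rewrite /ip /= /ipE /h mxdot_mulr -mulmxA tO ?mulmx1 //;
    exact: Uc.
- move=> i j x Ui Uj v; rewrite /h -mulmxA tM //; exact: Uc.
Qed.

End Glue.

(** * Change of quaternionic frame *)

Section TwistedConverse.
Variable R : realType.

(** The first basis vector of H^(n+1), from whose multiples a quaternion is read off. *)
Definition qe0 n : 'M[R]_(n.+1, 4) :=
  \matrix_l ((l == 0)%:R *: row_of_quat (qone R)).

Lemma qe0P n r : quat_of_row (row 0 (qscale r (qe0 n))) = r.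
Proof. by rewrite row_qscale rowK eqxx scale1r row_of_quatK qmul1r. Qed.

Lemma alg_aut_re (kappa : quat R -> quat R) r :
  is_alg_aut (qone R) (@qmul R) kappa -> (kappa r).1 = r.1.
Proof.
move=> kP; have [_ _ k1 _] := kP; have := alg_aut_isom kP r (qone R).
by rewrite k1 /qdot /= !(mxdotC _ 0) /mxdot !mul0mx mxtrace0 !addr0 !mulr1.
Qed.

Lemma id_alg_aut : is_alg_aut (qone R) (@qmul R) id.
Proof. by split=> //; exists id. Qed.

Lemma twisted_flat (g : 'M[R]_(0, 4) -> 'M[R]_(0, 4)) : OV g -> twisted g 1.
Proof.
move=> Og; split=> //; exists id; split; first exact: id_alg_aut.
  by move=> v r; rewrite [LHS]flatmx0 [RHS]flatmx0.
by rewrite scale1r.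
Qed.

Lemma qscale_inj n (r s : quat R) (v : 'M[R]_(n, 4)) : v != 0 ->
  qscale r v = qscale s v -> r = s.
Proof.
move=> v0 rs; apply/eqP; rewrite -subr_eq0; apply/eqP/qdot_eq0.
have := mxdot_qscale (r - s) v v.
rewrite (linB (qscale_linl v)) rs subrr {1}/mxdot mul0mx mxtrace0 => /esym/eqP.
by rewrite mulf_eq0 mxdot_eq0 (negPf v0) orbF => /eqP.
Qed.

Lemma qi_of_C : quat_of_C 'i%C = qi R.
Proof. by rewrite /quat_of_C /= scale1r. Qed.

Lemma qe0_neq0 n : qe0 n != 0.
Proof.
apply/eqP => e0; have := qe0P n (qone R); rewrite e0 (lin0 (qscale_linr _)).
by rewrite row0 (lin0 (@quat_of_row_linear R)) => -[] /eqP; rewrite eq_sym oner_eq0.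
Qed.

(** Comparing the two semilinearity conditions at the image of a nonzero vector shows
    that the automorphism of H maps i to w; it preserves real parts, so w is a real
    multiple of i. For n = 0 the automorphism may be taken to be the identity. *)
Lemma TSp_twisted n (g : 'M[R]_(n, 4) -> 'M[R]_(n, 4)) (w : R[i]) : TSp g ->
  (forall v, g (cscale 'i%C v) = cscale w (g v)) ->
  exists2 c, twisted g c & w = 'i%C -> c = 1.
Proof.
case: n g => [|n] g [Og [kappa [kP kg]]] gw; first by exists 1 => //;
  exact: twisted_flat.
have g0 : g (qe0 n) != 0.
  by rewrite -mxdot_eq0; have [_ ->] := Og; rewrite mxdot_eq0 qe0_neq0.
have ki : kappa (qi R) = quat_of_C w.
  by apply: (qscale_inj g0); rewrite -kg -[RHS]gw /cscale qi_of_C.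
have w0 : complex.Re w = 0 by have := alg_aut_re (qi R) kP; rewrite ki.
exists (complex.Im w); last by move=> ->.
split=> //; exists kappa; split=> //.
by rewrite ki quat_of_CE w0 scale0r add0r.
Qed.

Lemma TSp_UV_twisted n (g : 'M[R]_(n, 4) -> 'M[R]_(n, 4)) :
  (@TSp R n `&` @UV R n) g -> twisted g 1.
Proof.
by case=> gS [_ gC]; have [c gt c1] := TSp_twisted gS (gC 'i%C); rewrite -c1.
Qed.

Lemma TSp_TU_twisted n (g : 'M[R]_(n, 4) -> 'M[R]_(n, 4)) :
  (@TSp R n `&` @TU R n) g -> exists c, twisted g c.
Proof.
case=> gS [_ [kappa [_ _ gC]]].
by have [c gt _] := TSp_twisted gS (fun v => gC v 'i%C); exists c.
Qed.

End TwistedConverse.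

Section ChangeOfFrame.
Variables (R : realType) (X : topologicalType) (m n : nat).
Variables (xi : orth_bundle R X m) (I : Type) (U : I -> set X).
Variables (h : forall (i : I) (x : X), 'M[R]_(n, 4) -> xi x).
Variables (k : forall (i : I) (x : X), xi x -> 'M[R]_(n, 4)).
Hypothesis hP : forall i, chart_with (U i) (h i) (k i).

Lemma cvg_qscale T (F : set_system T) (FF : Filter F) p (r : T -> quat R)
    (v : T -> 'M[R]_(p, 4)) (r0 : quat R) (v0 : 'M[R]_(p, 4)) :
  row_of_quat (r t) @[t --> F] --> row_of_quat r0 -> v @ F --> v0 ->
  qscale (r t) (v t) @[t --> F] --> qscale r0 v0.
Proof.
move=> /cvg_mxP cr cv.
have e s (u : 'M[R]_(p, 4)) : qscale s u = vec_mx (mxvec u *m mxlin (qvec s)).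
  by rewrite mul_mxlin ?/qvec ?mxvecK //; exact: qvec_linr.
rewrite e; under eq_cvg do rewrite e.
apply: cvg_vec_mx; apply: cvg_mulmx; first exact: cvg_mxvec.
apply/cvg_mxP => i j.
have el s : mxlin (@qvec R p s) i j =
    \sum_b row_of_quat s 0 b * qvec (qbase R b) (delta_mx 0 i) 0 j.
  rewrite mxE {1}(qbaseE s) (lin_sum (qvec_linl _)) summxE.
  by apply: eq_bigr => b _; rewrite (linZ (qvec_linl _)) mxE.
rewrite el; under eq_cvg do rewrite el.
by apply: cvg_sumR => b; apply: cvgM; [exact: cr | exact: cvg_cst].
Qed.

(** When n > 0 the automorphism over which a transition function is semilinear can be
    read off from the images of the multiples of one vector; it is therefore unique,
    which gives the cocycle condition, and it varies continuously. For n = 0 it is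
    taken to be the identity. The predicate C carries a condition on the scalars c
    with kappa i = c i, such as c = 1 for complex linear transition functions. *)
Lemma change_of_frame (C : R -> Prop) : C 1 ->
  (forall i j x, U i x -> U j x -> exists g c,
     [/\ C c, twisted g c & forall v, h j x v = h i x (g v)]) ->
  exists kappa : I -> I -> X -> quat R -> quat R,
  [/\ forall i j x, U i x -> U j x -> is_alg_aut (qone R) (@qmul R) (kappa j i x) /\
        (exists2 c, C c & kappa j i x (qi R) = c *: qi R),
      forall i j x, U i x -> U j x -> forall r (u : xi x),
        h j x (qscale r (k j u)) = h i x (qscale (kappa j i x r) (k i u)),
      forall i j l x, U i x -> U j x -> U l x -> forall r,
        kappa j i x (kappa l j x r) = kappa l i x r,
      forall i x, U i x -> forall r, kappa i i x r = r
    & forall i j x r, U i x -> U j x ->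
        row_of_quat (kappa j i y r) @[y --> x] --> row_of_quat (kappa j i x r)].
Proof.
move=> C1 tr; move: h k hP tr; case: n => [|n'] h' k' hP' tr.
  exists (fun _ _ _ => id); split=> //.
  - move=> i j x Ui Uj; split; first exact: id_alg_aut.
    by exists 1; rewrite ?scale1r.
  - move=> i j x Ui Uj r u.
    have [_ _ hKi _ _] := hP' i; have [_ _ hKj _ _] := hP' j.
    rewrite [X in h' j x X](_ : _ = k' j x u);
      last by rewrite [LHS]flatmx0 [RHS]flatmx0.
    rewrite [X in h' i x X](_ : _ = k' i x u);
      last by rewrite [LHS]flatmx0 [RHS]flatmx0.
    by have [_ ->] := hKi _ Ui; have [_ ->] := hKj _ Uj.
  - by move=> i j x r Ui Uj; exact: cvg_cst.
have hK i x : U i x -> cancel (h' i x) (k' i x)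
  by case: (hP' i) => _ _ + _ _ => /[apply] -[].
have kK i x : U i x -> cancel (k' i x) (h' i x)
  by case: (hP' i) => _ _ + _ _ => /[apply] -[].
pose kappa j i x r : quat R := quat_of_row (row 0
  (k' i x (h' j x (qscale r (k' j x (h' i x (qe0 R n'))))))).
have kappaE i j x kap : U i x -> U j x ->
    (forall r u, h' j x (qscale r (k' j x u)) =
      h' i x (qscale (kap r) (k' i x u))) ->
    forall r, kappa j i x r = kap r.
  by move=> Ui Uj kE r; rewrite /kappa kE !hK // qe0P.
have kP i j x : U i x -> U j x -> exists kap, [/\ kappa j i x = kap,
    is_alg_aut (qone R) (@qmul R) kap, exists2 c, C c & kap (qi R) = c *: qi R &
    forall r u, h' j x (qscale r (k' j x u)) = h' i x (qscale (kap r) (k' i x u))].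
  move=> Ui Uj; have [g [c [Cc [_ [kap [kapP kg ki]]] gh]]] := tr i j x Ui Uj.
  have kE r u : h' j x (qscale r (k' j x u)) = h' i x (qscale (kap r) (k' i x u)).
    by rewrite gh kg -{2}[u](kK j x) // gh hK.
  by exists kap; split=> //; [apply: funext => r; exact: kappaE | exists c].
have kM i j x : U i x -> U j x -> forall r u,
    h' j x (qscale r (k' j x u)) = h' i x (qscale (kappa j i x r) (k' i x u)).
  by move=> Ui Uj; have [kap [-> _ _]] := kP i j x Ui Uj.
exists kappa; split=> //.
- by move=> i j x Ui Uj; have [kap [-> kapP kc _]] := kP i j x Ui Uj.
- move=> i j l x Ui Uj Ul r;
    apply/esym/(kappaE i l x (fun r => kappa j i x (kappa l j x r))) => //.
  by move=> {}r u; rewrite (kM j l) // (kM i j).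
- by move=> i x Ui r; apply: (kappaE i i x id).
- move=> i j x r Ui Uj; rewrite quat_of_rowK; under eq_cvg do rewrite quat_of_rowK.
  have c1 : k' j y (h' i y (qe0 R n')) @[y --> x] --> k' j x (h' i x (qe0 R n')).
    apply: (cvg_coord (hP' j) Uj); apply: (cvg_chart (hP' i) Ui); first exact:
      cvg_id.
    exact: cvg_cst.
  have c2 : qscale r (k' j y (h' i y (qe0 R n'))) @[y --> x] -->
      qscale r (k' j x (h' i x (qe0 R n'))).
    by apply: cvg_qscale c1; exact: cvg_cst.
  have /cvg_mxP c3 : k' i y (h' j y (qscale r (k' j y (h' i y (qe0 R n')))))
    @[y --> x] -->
      k' i x (h' j x (qscale r (k' j x (h' i x (qe0 R n'))))).
    apply: (cvg_coord (hP' i) Ui); apply: (cvg_chart (hP' j) Uj _ c2);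
      exact: cvg_id.
  by apply/cvg_mxP => a b; rewrite mxE; under eq_cvg do rewrite mxE; exact: c3.
Qed.

End ChangeOfFrame.

(** * The line bundle of an atlas *)

Section ImaginaryPlane.
Variable R : realType.
Implicit Types y z : 'rV[R]_2.

(** R^2 is identified with the plane C j = R j + R k in H; [rot] is left multiplication
    by i on it. *)
Definition plane y : quat R := (0, \row_i [:: 0; y 0 0; y 0 1]`_i).
Definition coplane (r : quat R) : 'rV[R]_2 := \row_i [:: r.2 0 1; r.2 0 2]`_i.
Definition rot y : 'rV[R]_2 := \row_i [:: - y 0 1; y 0 0]`_i.

Lemma rV2P y z : y 0 0 = z 0 0 -> y 0 1 = z 0 1 -> y = z.
Proof.
move=> e0 e1; apply/rowP => -[[|[|//]] lt2].
- by rewrite (_ : Ordinal lt2 = 0) //; apply: val_inj.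
- by rewrite (_ : Ordinal lt2 = 1) //; apply: val_inj.
Qed.

Lemma mxdot2E y z : mxdot y z = y 0 0 * z 0 0 + y 0 1 * z 0 1.
Proof.
rewrite mxdotE big_ord1 big_ord_recr big_ord1 /=.
by congr (y _ _ * z _ _ + y _ _ * z _ _); apply: val_inj.
Qed.

Lemma plane_linear : linear plane.
Proof.
by move=> c y z; apply: quatP; rewrite /= ?mxE /= ?mxE /GRing.scale /=; ring.
Qed.

Lemma coplane_linear : linear coplane.
Proof. by move=> c r s; apply: rV2P; rewrite !mxE /= ?mxE. Qed.

Lemma rot_linear : linear rot.
Proof. by move=> c y z; apply: rV2P; rewrite !mxE /= ?mxE //; ring. Qed.

Lemma planeK : cancel plane coplane.
Proof. by move=> y; apply: rV2P; rewrite !mxE. Qed.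

Lemma coplaneK (r : quat R) : r.1 = 0 -> r.2 0 0 = 0 -> plane (coplane r) = r.
Proof. by move=> r1 r2; apply: quatP; rewrite ?mxE. Qed.

Lemma qdot_plane y z : qdot (plane y) (plane z) = mxdot y z.
Proof. by rewrite /qdot /= mxdot3E mxdot2E !mxE /=; ring. Qed.

Lemma plane_rot y : plane (rot y) = qmul (qi R) (plane y).
Proof.
by apply: quatP; rewrite qmulE /= ?mxdot3E ?(cross3E, mxE) /= ?mxE /=; ring.
Qed.

Lemma rotK y : rot (rot y) = - y.
Proof. by apply: rV2P; rewrite !mxE /= ?mxE /=. Qed.

Lemma mxdot_rot y z : mxdot (rot y) (rot z) = mxdot y z.
Proof. by rewrite !mxdot2E !mxE /=; ring. Qed.

Lemma mxdot_rot0 y : mxdot y (rot y) = 0.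
Proof. by rewrite !mxdot2E !mxE /=; ring. Qed.

Lemma cvg_rot T (F : set_system T) (FF : Filter F) (y : T -> 'rV[R]_2)
    (z : 'rV[R]_2) :
  y @ F --> z -> rot (y t) @[t --> F] --> rot z.
Proof.
move=> /cvg_mxP yz; apply/cvg_mxP => i j; rewrite mxE; under eq_cvg do rewrite mxE.
case: j => [[|[|//]] lt2] /=; [apply: cvgN|]; exact: yz.
Qed.

Lemma cvg_coplane T (F : set_system T) (FF : Filter F) (r : T -> quat R)
    (r0 : quat R) :
  row_of_quat (r t) @[t --> F] --> row_of_quat r0 ->
  coplane (r t) @[t --> F] --> coplane r0.
Proof.
pose f (v : 'rV[R]_4) := coplane (quat_of_row v).
have e s : coplane s = row_of_quat s *m mxlin f.
  rewrite mul_mxlin /f ?row_of_quatK // => c v w.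
  by rewrite quat_of_row_linear coplane_linear.
move=> cr; rewrite e; under eq_cvg do rewrite e.
by apply: cvg_mulmx => //; exact: cvg_cst.
Qed.

Lemma quat_split (r : quat R) :
  r = r.1 *: qone R + r.2 0 0 *: qi R + plane (coplane r).
Proof.
by apply: quatP; rewrite /= ?mxE /= ?mxE /GRing.scale /=; ring.
Qed.

(** The plane C j is the orthogonal complement of 1 and i, and automorphisms of H are
    orthogonal. *)
Lemma aut_plane (kappa : quat R -> quat R) c y :
  is_alg_aut (qone R) (@qmul R) kappa -> kappa (qi R) = c *: qi R ->
  plane (coplane (kappa (plane y))) = kappa (plane y).
Proof.
move=> kP ki; apply: coplaneK; first by rewrite (alg_aut_re _ kP).
have kd := alg_aut_isom kP.
have qiE (r : quat R) : qdot (qi R) r = r.2 0 0.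
  by rewrite /qdot /= mxdot3E !mxE /=; ring.
have iP : qdot (qi R) (plane y) = 0 by rewrite qiE mxE.
have c0 : c != 0.
  apply/eqP => c0; have := kd (qi R) (qi R).
  rewrite ki c0 scale0r (lin0 (qdot_linl _)) qiE mxE /= => /eqP.
  by rewrite eq_sym oner_eq0.
have := kd (qi R) (plane y); rewrite iP ki (linZ (qdot_linl _)) => /eqP.
by rewrite scaler_eq0 (negPf c0) /= qiE => /eqP.
Qed.

End ImaginaryPlane.

Lemma fam_map_continuousP (R : realType) (X : topologicalType) (E1 E2 G : vfam R X)
    (f : forall x, sum_fam E1 E2 x -> G x) :
  (forall (T : Type) (F : set_system T) (FF : Filter F) (b : T -> X)
      (v1 : forall t, E1 (b t)) (v2 : forall t, E2 (b t)) x (w1 : E1 x) (w2 : E2 x),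
    inTot (v1 t) @[t --> F] --> (inTot w1 : tot E1) ->
    inTot (v2 t) @[t --> F] --> (inTot w2 : tot E2) ->
    inTot (f (b t) (v1 t, v2 t)) @[t --> F] --> (inTot (f x (w1, w2)) : tot G)) ->
  fam_map_continuous f.
Proof.
move=> H [x [w1 w2]]; pose e0 : tot (sum_fam E1 E2) := existT _ x (w1, w2).
have e1 : inTot (projT2 e).1 @[e --> e0] --> (inTot w1 : tot E1) :=
  @sum_top_fst R X E1 E2 e0.
have e2 : inTot (projT2 e).2 @[e --> e0] --> (inTot w2 : tot E2) :=
  @sum_top_snd R X E1 E2 e0.
have c := H _ (nbhs e0) _ (fun e => projT1 e) _ _ x w1 w2 e1 e2.
suff : inTot (f (projT1 e) (projT2 e)) @[e --> e0] -->
  (inTot (f x (w1, w2)) : tot G) by [].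
apply: (@cvg_trans _ (inTot (f (projT1 e) ((projT2 e).1, (projT2 e).2))
  @[e --> e0])); last exact: c.
apply: (@near_eq_cvg _ _ (nbhs e0)); apply: (@filterE _ (nbhs e0)) => -[y [v1 v2]].
exact: erefl.
Qed.

Section BuildLine.
Variables (R : realType) (X : topologicalType) (delta : orth_bundle R X 1).
Variables (I : Type) (U : I -> set X) (a : I -> forall x, delta x).
Variable kappa : I -> I -> X -> quat R -> quat R.
Hypotheses (cov : forall x, exists i, U i x).
Hypothesis us : forall i, unit_section (U i) (a i).
Hypothesis kP : forall i j x, U i x -> U j x ->
  is_alg_aut (qone R) (@qmul R) (kappa j i x) /\
  kappa j i x (qi R) = ip (a j x) (a i x) *: qi R.
Hypothesis kM : forall i j l x, U i x -> U j x -> U l x -> forall r,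
  kappa j i x (kappa l j x r) = kappa l i x r.
Hypothesis k1 : forall i x, U i x -> forall r, kappa i i x r = r.
Hypothesis kc : forall i j x r, U i x -> U j x ->
  row_of_quat (kappa j i y r) @[y --> x] --> row_of_quat (kappa j i x r).

Let oU i : open (U i) := us_open (us i).
Let aa i x (Ui : U i x) := us_unit (us i) Ui.

Let t j i x := mxlin (fun y => coplane (kappa j i x (plane y))).

Let tE i j x y : U i x -> U j x -> y *m t j i x = coplane (kappa j i x (plane y)).
Proof.
move=> Ui Uj; apply: (mul_mxlin (f := fun y => coplane (kappa j i x (plane y)))).
have [[kl _ _ _] _] := kP Ui Uj.
by move=> c u v; rewrite plane_linear kl coplane_linear.
Qed.

Let plane_t i j x y : U i x -> U j x -> plane (y *m t j i x) =
  kappa j i x (plane y).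
Proof.
move=> Ui Uj; rewrite tE //; have [ka ki] := kP Ui Uj; exact: aut_plane ka ki.
Qed.

Let mulmx_ext p (A B : 'M[R]_p) : (forall y : 'rV_p, y *m A = y *m B) -> A = B.
Proof. by move=> AB; apply/row_matrixP => l; rewrite !rowE. Qed.

(** The plane bundle underlying lambda is glued from copies of C j along the
    restrictions of the automorphisms. *)
Lemma line_bundle : exists (L : orth_bundle R X 2)
    (l : forall (i : I) (x : X), 'rV[R]_2 -> L x)
      (k : forall (i : I) (x : X), L x -> 'rV[R]_2),
  [/\ forall i, chart_with (U i) (l i) (k i),
      forall i x, U i x -> forall v w, ip (l i x v) (l i x w) = mxdot v w
    & forall i j x, U i x -> U j x -> forall y,
        l j x y = l i x (coplane (kappa j i x (plane y)))].
Proof.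
have [i x Ui|i j s x Ui Uj Us|i j x Ui Uj|i j x Ui Uj|L [l [k [lP lI lt]]]] :=
    @glue_bundle R X 2 I U t oU cov.
- apply: mulmx_ext => y; apply: (can_inj (@planeK R)).
  by rewrite plane_t // k1 // mulmx1.
- apply: mulmx_ext => y; apply: (can_inj (@planeK R)).
  by rewrite mulmxA !plane_t // kM.
- apply: cvg_continuous; apply/cvg_mxP => r s; rewrite mxE.
  under eq_cvg do rewrite mxE.
  by apply: (iffLR (cvg_mxP _ _)); apply: cvg_coplane; exact: kc.
- apply: mxdot_ext => u v; rewrite mulmxA mulmx1 mxdotC mxdot_mulr trmxK mxdotC.
  rewrite -qdot_plane !plane_t //; have [ka _] := kP Uj Ui.
  by rewrite (alg_aut_isom ka) qdot_plane.
- exists L, l, k; split=> // i j x Ui Uj y; rewrite -tE //; exact: lt.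
Qed.

Let L_lin m (L : orth_bundle R X m) W h k x : W x -> @chart_with R X L 1 m W h k ->
  linear (k x).
Proof.
move=> Wx [_ hl hk _ _] c u v; have [hK kK] := hk _ Wx.
by apply: (can_inj hK); rewrite hl // !kK.
Qed.

Let a_trans i j x d : U i x -> U j x ->
  ip d (a j x) = ip (a j x) (a i x) * ip d (a i x).
Proof.
move=> Ui Uj; have dP := ip_inner delta x.
by rewrite {1}(delta_span (aa Ui) (a j x)) (innerZr dP).
Qed.

(** The unit section a_i of delta acts as multiplication by i in the i-th copy of C j.
    An automorphism that changes the sign of i changes that of a_i as well, so this
    is independent of the chart. *)
Lemma C_line_exists : exists (lam : C_line delta)
    (l : forall (i : I) (x : X), 'rV[R]_2 -> lam x)
      (k : forall (i : I) (x : X), lam x -> 'rV[R]_2),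
  [/\ forall i, chart_with (U i) (l i) (k i),
      forall i x, U i x -> forall v w, ip (l i x v) (l i x w) = mxdot v w,
      forall i j x, U i x -> U j x -> forall y,
        l j x y = l i x (coplane (kappa j i x (plane y)))
    & forall i x, U i x -> forall d y,
        lam_mul d (l i x y) = l i x (ip d (a i x) *: rot y)].
Proof.
have [L [l [k [lP lI lt]]]] := line_bundle.
have ll i x : U i x -> linear (l i x) by case: (lP i) => _ + _ _ _; apply.
have lK i x : U i x -> cancel (l i x) (k i x)
  by case: (lP i) => _ _ + _ _ => /[apply] -[].
have kK i x : U i x -> cancel (k i x) (l i x)
  by case: (lP i) => _ _ + _ _ => /[apply] -[].
have kl i x (Ui : U i x) : linear (k i x) := L_lin Ui (lP i).
have [c Uc] := choice cov.
pose J i x (d : delta x) (w : L x) : L x := l i x (ip d (a i x) *: rot (k i x w)).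
have JE i j x d w : U i x -> U j x -> J j x d w = J i x d w.
  move=> Ui Uj; rewrite /J (lt i) //; have [ka ki] := kP Ui Uj;
    have [kal _ _ kaM] := ka.
  have -> : k i x w = coplane (kappa j i x (plane (k j x w))).
    by rewrite -[in LHS](kK j x Uj w) (lt i) // lK.
  congr (l i x _); apply: (can_inj (@planeK R)).
  rewrite (aut_plane _ ka ki) !(linZ (@plane_linear R))
    (linZ kal) !plane_rot kaM ki.
  rewrite (aut_plane _ ka ki) (linZ (qmul_linl _)) scalerA; congr (_ *: _).
  (* The sign of the automorphism on i cancels that of a_j relative to a_i. *)
  rewrite (a_trans _ Ui Uj) mulrAC -expr2 line_unit ?mul1r //; exact: aa.
pose act x (z : sum_fam (triv_fam R X) delta x) (w : L x) : L x :=
  z.1 *: w + J (c x) x z.2 w.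
have actE i x z w : U i x -> act x z w = z.1 *: w + J i x z.2 w.
  by move=> Ui; rewrite /act (JE i) //; exact: Uc.
have dP x := ip_inner delta x; have LP x := ip_inner L x.
have Jl i x : U i x -> is_bilinear (J i x).
  move=> Ui; split=> [d b u v|w b d e]; rewrite /J.
    by rewrite kl // rot_linear scalerDr scalerA mulrC -scalerA ll.
  by rewrite (innerDl (dP x)) (innerZl (dP x)) scalerDl -scalerA ll.
have modP x : is_left_module (1, 0) (cplx_mul (@ip _ _ _ delta x)) (@act x).
  have Ux := Uc x; have [Jl1 Jl2] := Jl _ _ Ux; split.
  - split=> [z b u v|w b z z']; rewrite /act.
      by rewrite Jl1 !scalerDr !scalerA mulrC !addrA; congr (_ + _); rewrite addrAC.
    rewrite Jl2 !scalerDr /= !scalerDl -!scalerA !addrA; congr (_ + _).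
    by rewrite addrAC.
  - by move=> w; rewrite /act scale1r (lin0 (Jl2 w)) addr0.
  - move=> z z' w; rewrite /act /cplx_mul /= Jl2 (linZ (Jl2 _)) (linD (Jl1 _))
      (linZ (Jl1 _)).
    have JJ d e : J (c x) x d (J (c x) x e w) = - (ip d e) *: w.
      rewrite /J lK // (linZ (@rot_linear R)) rotK -scaleN1r !scalerA mulrN1.
      rewrite (linZ (ll _ _ Ux)) kK //; congr (- _ *: _).
      by rewrite [in RHS](delta_span (aa Ux) e) (innerZr (dP x)) mulrC.
    rewrite JJ scalerDr scalerA scalerBl -!addrA scaleNr; congr (_ + _).
    by rewrite addrC -addrA.
have actc : fam_map_continuous (E := sum_fam (sum_fam (triv_fam R X) delta) L)
    (fun x e => act x e.1 e.2).
  apply: fam_map_continuousP => T F FF b v1 v2 x w1 w2 c1 c2.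
  have [c11 c12] := iffLR (cvg_sumP _ _) c1.
  have bx := cvg_base c2.
  have [_ cs] := iffLR (cvg_trivP _ (fun t => (v1 t).1) _ _) c11.
  have Ux := Uc x.
  apply: (@cvg_trans _ (inTot ((v1 t).1 *: v2 t + J (c x) (b t) (v1 t).2 (v2 t))
    @[t --> F])).
    apply: near_eq_cvg; apply: filterS (near_base (oU _) Ux bx) => s Us.
    by rewrite (actE (c x)).
  apply: cvg_lin => //; apply: (cvg_chart (lP _) Ux bx); apply: cvgZ.
    apply: cvg_ip => //; have [_ _ ac] := us (c x).
    exact: cvg_comp bx (ac _ Ux).
  by apply: cvg_rot; exact: cvg_coord (lP _) Ux c2.
have actI x (z : sum_fam (triv_fam R X) delta x) (w : L x) :
    ip (act x z w) (act x z w) = (z.1 ^+ 2 + ip z.2 z.2) * ip w w.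
  have Ux := Uc x; pose y := k (c x) x w.
  have wE : w = l (c x) x y by rewrite /y kK.
  have -> : act x z w = l (c x) x (z.1 *: y + ip z.2 (a (c x) x) *: rot y).
    by rewrite ll // -wE.
  have -> : ip w w = mxdot y y by rewrite wE lI.
  rewrite lI // [in RHS](delta_span (aa Ux) z.2).
  rewrite (innerZl (dP x)) (innerZr (dP x)) (aa Ux).
  rewrite !mxdotDl !mxdotDr !mxdotZl !mxdotZr mxdot_rot (mxdotC (rot y)) mxdot_rot0.
  by ring.
exists (@CLine R X delta L act modP actc actI), l, k; split=> // i x Ui d y.
by rewrite /lam_mul /= (actE i) //= scale0r add0r /J lK.
Qed.

End BuildLine.

(** * The H_lambda-structure of an atlas *)

Lemma cvg_row_of_quat (R : realType) T (F : set_system T) (FF : Filter F)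
    (r : T -> quat R) (r0 : quat R) :
  (r t).1 @[t --> F] --> r0.1 -> (r t).2 @[t --> F] --> r0.2 ->
  row_of_quat (r t) @[t --> F] --> row_of_quat r0.
Proof.
move=> c1 /cvg_mxP c2; apply/cvg_mxP => i j; rewrite !ord1.
have e0 (q : quat R) : row_of_quat q 0 0 = q.1.
  by rewrite -[RHS](congr1 (fun q : quat R => q.1 : R) (row_of_quatK q)).
have e1 (q : quat R) s : row_of_quat q 0 (rshift 1 s) = q.2 0 s.
  by rewrite -[RHS](congr1 (fun q : quat R => q.2 0 s) (row_of_quatK q)) /=
    [in RHS]mxE.
case: (unliftP 0 j) => [s ->|->]; last by rewrite e0; under eq_cvg do rewrite e0.
rewrite (_ : lift 0 s = rshift 1 s); last exact: val_inj.
by rewrite e1; under eq_cvg do rewrite e1; exact: c2.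
Qed.

Section BuildStructure.
Variables (R : realType) (X : topologicalType) (m n : nat) (xi : orth_bundle R X m).
Variables (I : Type) (U : I -> set X).
Variables (h : forall (i : I) (x : X), 'M[R]_(n, 4) -> xi x).
Hypothesis cov : forall x, exists i, U i x.
Hypothesis hP : forall i, is_chart (U i) (h i).

(** The section f_i = j of the i-th copy of C j and the unit section a_i give a frame
    of H_lambda over U_i, and these frames differ by the automorphisms kappa. So the
    standard action of H on H^n, carried to xi by a chart and to H_lambda by the
    frame, is the same for all charts. *)
Lemma H_structure_exists (delta : orth_bundle R X 1) (a : I -> forall x, delta x)
    (k : forall (i : I) (x : X), xi x -> 'M[R]_(n, 4))
    (kappa : I -> I -> X -> quat R -> quat R) :
  (forall i, chart_with (U i) (h i) (k i)) ->
  (forall i, unit_section (U i) (a i)) ->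
  (forall i j x, U i x -> U j x ->
    is_alg_aut (qone R) (@qmul R) (kappa j i x) /\
    kappa j i x (qi R) = ip (a j x) (a i x) *: qi R) ->
  (forall i j x, U i x -> U j x -> forall r (u : xi x),
    h j x (qscale r (k j x u)) = h i x (qscale (kappa j i x r) (k i x u))) ->
  (forall i j l x, U i x -> U j x -> U l x -> forall r,
    kappa j i x (kappa l j x r) = kappa l i x r) ->
  (forall i x, U i x -> forall r, kappa i i x r = r) ->
  (forall i j x r, U i x -> U j x ->
    row_of_quat (kappa j i y r) @[y --> x] --> row_of_quat (kappa j i x r)) ->
  exists lam : C_line delta, has_H_structure lam xi.
Proof.
move=> hkP us kP hkap kM k1 kc.
have [lam [l [lk [lP lI lt lmul]]]] := C_line_exists cov us kP kM k1 kc.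
exists lam.
have aa i x (Ui : U i x) := us_unit (us i) Ui.
have oU i : open (U i) := us_open (us i).
pose f i x := l i x (delta_mx 0 0).
have ff i x : U i x -> ip (f i x) (f i x) = 1.
  by move=> Ui; rewrite lI // mxdot2E !mxE /= mulr1 mulr0 addr0.
have ll i x : U i x -> linear (l i x) by case: (lP i) => _ + _ _ _; apply.
have rot0 : rot (delta_mx 0 0) = delta_mx 0 1 :> 'rV[R]_2.
  by apply: rV2P; rewrite !mxE /= ?mxE /= ?oppr0.
have frameE i x r : U i x -> frame (a i x) (f i x) r =
    (r.1, (r.2 0 0 *: a i x, l i x (coplane r))).
  move=> Ui; rewrite /frame /frame_im /f lmul // aa // scale1r rot0.
  rewrite -[X in _ + X](linZ (ll _ _ Ui)) -(ll _ _ Ui).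
  congr (_, (_, l i x _)).
  by apply: rV2P; rewrite !mxE /=; ring.
have frame_change i j x r : U i x -> U j x ->
    frame (a j x) (f j x) r = frame (a i x) (f i x) (kappa j i x r).
  move=> Ui Uj; rewrite !frameE // (lt i j) //.
  have [ka ki] := kP i j x Ui Uj; have [kl _ _ _] := ka.
  have pl := aut_plane (coplane r) ka ki.
  rewrite (alg_aut_re _ ka); congr (_, (_, l i x _)).
    rewrite {1}(delta_span (aa _ _ Ui) (a j x)) scalerA; congr (_ *: _).
    rewrite [in RHS](quat_split r) !(linD kl) !(linZ kl) ki -pl.
    have [_ _ -> _] := ka; rewrite /= !mxE /=; ring.
  rewrite [in RHS](quat_split r) !(linD kl) !(linZ kl) ki -pl.
  have [_ _ -> _] := ka.
  by apply: rV2P; rewrite !mxE /= ?mxE /=; ring.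
have [c Uc] := choice cov.
pose loc i x (p : H_fam lam x) (u : xi x) : xi x :=
  h i x (qscale (frame_inv (a i x) (f i x) p) (k i x u)).
have locE i j x p u : U i x -> U j x -> loc j x p u = loc i x p u.
  move=> Ui Uj; rewrite /loc (hkap i j) //; congr (h i x (qscale _ _)).
  apply: (can_inj (frameK (aa _ _ Ui) (ff _ _ Ui))).
  rewrite -frame_change // !frame_invK //;
    [exact: aa|exact: ff|exact: aa|exact: ff].
exists (fun x p u => loc (c x) x p u); split=> [x|].
  have Ux := Uc x; have [_ hl hK _ _] := hkP (c x); have [hkK kK] := hK _ Ux.
  have hlx := hl _ Ux.
  have klx : linear (k (c x) x).
    by move=> b u v; apply: (can_inj hkK); rewrite hlx // !kK.
  have fK := frame_invK (aa _ _ Ux) (ff _ _ Ux);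
    have Kf := frameK (aa _ _ Ux) (ff _ _ Ux).
  have fil : linear (frame_inv (a (c x) x) (f (c x) x)).
    by move=> b p q; apply: (can_inj Kf); rewrite frame_linear !fK.
  rewrite /loc; split=> [|u|p q u].
  - split=> [p b u v|u b p q]; first by rewrite klx (qscale_linr _ b) hlx.
    by rewrite fil qscale_linl hlx.
  - by rewrite -(frame1 (a (c x) x) (f (c x) x)) Kf qscale1 kK.
  - rewrite -{1}[p]fK -{1}[q]fK -frameM ?aa ?ff // Kf qscaleA hkK //.
apply: fam_map_continuousP => T F FF b p u x p0 u0 cp cu.
have Ux := Uc x; have bx := cvg_base cu.
apply: (@cvg_trans _ (inTot (loc (c x) (b s) (p s) (u s)) @[s --> F])).
  apply: near_eq_cvg; apply: filterS (near_base (oU _) Ux bx) => s Us.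
  by rewrite (locE (c x)).
apply: (cvg_chart (hkP _) Ux bx); apply: cvg_qscale;
  last exact: cvg_coord (hkP _) Ux cu.
have [cp1 cp2] := iffLR (cvg_sumP _ _) cp.
have [_ c1] := iffLR (cvg_trivP _ (fun s => (p s).1) _ _) cp1.
have [cp21 cp22] := iffLR (cvg_sumP _ _) cp2.
have ca : inTot (a (c x) (b s)) @[s --> F] --> (inTot (a (c x) x) : tot delta).
  exact: cvg_comp bx (us_cont (us _) Ux).
have cf : inTot (f (c x) (b s)) @[s --> F] --> (inTot (f (c x) x) : tot lam).
  by apply: (cvg_chart (lP _) Ux bx); exact: cvg_cst.
apply: cvg_row_of_quat; first exact: c1.
apply/cvg_mxP => r s; rewrite mxE; under eq_cvg do rewrite mxE.
case: s => [[|[|[|//]]] lt3] /=; apply: cvg_ip => //.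
exact: cvg_lam_mul.
Qed.

End BuildStructure.

Section BackwardTheorems.
Variables (R : realType) (X : topologicalType) (m n : nat) (xi : orth_bundle R X m).

Lemma reduces_U_H_structure : reduces_to xi (@TSp R n `&` @UV R n) ->
  exists lam : complex_line R X, has_H_structure lam xi.
Proof.
case=> [I [U [h [cov hP hI tr]]]].
have [k hkP] := choice (fun i => iffLR (is_chartP _ _) (hP i)).
have oU i : open (U i) by case: (hkP i).
have [||kappa [kP kE kM k1 kc]] := @change_of_frame R X m n xi I U h k hkP
  (fun c => c = 1) _ _.
- by [].
- move=> i j x Ui Uj; have [g gG gh] := tr i j x Ui Uj.
  by exists g, 1; split=> //; exact: TSp_UV_twisted.
apply: (@H_structure_exists R X m n xi I U h cov (triv_line R X)
  (fun _ _ => 1 : R) k kappa) => //.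
- move=> i; split; first exact: oU.
    by move=> x _; exact: mulr1.
  by move=> x _; apply/cvg_trivP; split; [exact: cvg_id | exact: cvg_cst].
- move=> i j x Ui Uj; have [ka [c -> ki]] := kP i j x Ui Uj; split=> //.
  by rewrite ki /ip /= /triv_ip mulr1.
Qed.

Lemma reduces_TU_H_structure : reduces_to xi (@TSp R n `&` @TU R n) ->
  exists (delta : orth_bundle R X 1) (lam : C_line delta), has_H_structure lam xi.
Proof.
case=> [I [U [h [cov hP hI tr]]]].
have [k hkP] := choice (fun i => iffLR (is_chartP _ _) (hP i)).
have oU i : open (U i) by case: (hkP i).
have [||kappa [kP kE kM k1 kc]] := @change_of_frame R X m n xi I U h k hkP
  (fun=> True) _ _.
- by [].
- move=> i j x Ui Uj; have [g gG gh] := tr i j x Ui Uj.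
  by have [c gt] := TSp_TU_twisted gG; exists g, c.
pose eps j i x : R := (kappa j i x (qi R)).2 0 0.
have kqi i j x : U i x -> U j x -> kappa j i x (qi R) = eps j i x *: qi R.
  move=> Ui Uj; have [ka [c _ ki]] := kP i j x Ui Uj.
  by rewrite /eps ki /= !mxE /= mulr1.
have qiqi : qdot (qi R) (qi R) = 1 by rewrite /qdot /= mxdot3E !mxE /=; ring.
have eps_inj (c d : R) : c *: qi R = d *: qi R -> c = d.
  by move=> /(congr1 (fun q : quat R => q.2 0 0)); rewrite /= !mxE /= !mulr1.
pose t j i x : 'M[R]_1 := (eps j i x)%:M.
have [i x Ui|i j s x Ui Uj Us|i j x Ui Uj|i j x Ui Uj|delta [l [lk [lP lI lt]]]] :=
    @glue_bundle R X 1 I U t oU cov.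
- by rewrite /t /eps k1 // mxE /=.
- rewrite /t -scalar_mxM; congr (_%:M); apply: eps_inj.
  have [[kl _ _ _] _] := kP s j x Us Uj.
  by rewrite -kqi // -(kM s j i) // (kqi j i) // (linZ kl) (kqi s j) // scalerA.
- have e (q : quat R) : row_of_quat q 0 (rshift 1 0) = q.2 0 0.
    by rewrite -[RHS](congr1 (fun q : quat R => q.2 0 0) (row_of_quatK q)) /=
      [in RHS]mxE.
  have tE y : t i j y 0 0 = row_of_quat (kappa i j y (qi R)) 0 (rshift 1 0).
    by rewrite e mxE eqxx mulr1n.
  have /cvg_mxP/(_ 0 (rshift 1 0)) c := kc j i x (qi R) Uj Ui.
  apply: cvg_continuous; apply/cvg_mxP => r s; rewrite !ord1 tE.
  by under eq_cvg do rewrite tE; exact: c.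
- rewrite /t tr_scalar_mx -scalar_mxM; congr (_%:M).
  have [ka _] := kP j i x Uj Ui; have := alg_aut_isom ka (qi R) (qi R).
  rewrite kqi // (linZ (qdot_linl _)) qdotC (linZ (qdot_linl _)) qiqi.
  by rewrite /GRing.scale /= mulr1.
exists delta; have [||lam Hlam] := @H_structure_exists R X m n xi I U h cov delta
  (fun i x => l i x (const_mx 1)) k kappa hkP _ _ kE kM k1 kc; last by exists lam.
- move=> i; split; first exact: oU.
    by move=> x Ui; rewrite lI // mxdotE !big_ord1 !mxE mulr1.
  by move=> x Ui; apply: (cvg_chart (lP i) Ui); [exact: cvg_id | exact: cvg_cst].
- move=> i j x Ui Uj; have [ka _] := kP i j x Ui Uj; split=> //.
  rewrite kqi // (lt j i) // lI //; congr (_ *: _).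
  by rewrite /t mul_mx_scalar mxdotE !big_ord1 !mxE !mulr1.
Qed.

End BackwardTheorems.

(** * The equivalences *)

Theorem proposition5p4 (R : realType) (X : topologicalType) (n : nat)
    (xi : orth_bundle R X (4 * n)) :
  compact [set: X] -> hausdorff_space X ->
  ((exists lam : complex_line R X, has_H_structure lam xi) <->
     reduces_to xi (@TSp R n `&` @UV R n)) /\
  ((exists (delta : orth_bundle R X 1) (lam : C_line delta),
       has_H_structure lam xi) <->
     reduces_to xi (@TSp R n `&` @TU R n)).
Proof.
move=> _ _; move: xi; rewrite mulnC => xi; split; split.
- by case=> lam; exact: H_structure_reduces_U.
- exact: reduces_U_H_structure.
- by case=> delta [lam]; exact: H_structure_reduces_TU.
- exact: reduces_TU_H_structure.
Qed.
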